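(* Let $n\ge 1$. For any $(u,P),(v,Q)\in\mathbb R\times\mathbb R_n[X]$ one has $$W(u,P)\,W(v,Q)=W\big((u,P)\circ(v,Q)\big),$$ where $$(u,P)\circ(v,Q):=\big(u+v,\;T_{u+v}^{-1}(T_uP+T_vS_uQ)\big).$$
   Context: $\mathbb R_n[X]$ is the real vector space of real polynomials in one indeterminate of degree at most $n$. On $L^2(\mathbb R)$ the position and momentum operators are $(q\varphi)(x)=x\varphi(x)$ and $(p\varphi)(x)=\frac1i\frac{\partial}{\partial x}\varphi(x)$. For $u\in\mathbb R$ and $P\in\mathbb R_n[X]$, the symmetric operator $up+P(q)$ defined on $C_c^\infty(\mathbb R)$ is essentially self-adjoint, and $W(u,P):=e^{i(up+P(q))}$ denotes the unitary operator on $L^2(\mathbb R)$ obtained by exponentiating its closure. For $u\in\mathbb R$, $S_u:\mathbb R_n[X]\to\mathbb R_n[X]$ is the translation $(S_uP)(X)=P(X+u)$. For $w\in\mathbb R$, $T_w:\mathbb R_n[X]\to\mathbb R_n[X]$ is the linear map with $T_0=\mathrm{id}$ and, for $w\ne0$, $(T_wP)(X)=\frac1w\int_0^wP(X+y)\,dy$. Each $T_w$ is invertible. *)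

(* Defs.v *)
From HB Require Import structures.
From mathcomp Require Import all_boot all_order all_algebra complex.
From mathcomp Require Import all_classical all_reals all_analysis.
From mathcomp Require Import measurable_realfun ring_quotient qpoly.
Set Implicit Arguments.
Unset Strict Implicit.
Unset Printing Implicit Defensive.
Import Order.TTheory GRing.Theory Num.Theory.
Import numFieldNormedType.Exports.

Local Open Scope classical_set_scope.
Local Open Scope ring_scope.
Local Open Scope complex_scope.

Section SquareIntegrable.
Context {R : realType}.
Local Notation mu := (@lebesgue_measure R).
Implicit Types f g : R -> R[i].

Definition modulus (z : R[i]) : R := complex.Re `|z|.

Definition cmeasurable f :=
  measurable_fun [set: R] (@complex.Re R \o f) /\
  measurable_fun [set: R] (@complex.Im R \o f).

Definition sqint : {pred R -> R[i]} :=
  fun f => `[< cmeasurable f /\ finite_norm mu 2%:E (modulus \o f) >].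

Lemma modulusE (z : R[i]) : (modulus z)%:C = `|z|.
Proof. by rewrite /modulus normc_def. Qed.

Lemma modulus_ge0 (z : R[i]) : 0 <= modulus z.
Proof. by rewrite -ler0c modulusE. Qed.

Lemma modulusD (z w : R[i]) : modulus (z + w) <= modulus z + modulus w.
Proof. by rewrite -lecR rmorphD/= !modulusE ler_normD. Qed.

Lemma modulusM (z w : R[i]) : modulus (z * w) = modulus z * modulus w.
Proof. by apply: complexI; rewrite rmorphM/= !modulusE normrM. Qed.

Lemma cmeasurableD f g : cmeasurable f -> cmeasurable g -> cmeasurable (f + g).
Proof.
move=> [rf jf] [rg jg]; split.
- rewrite (_ : _ \o _ = (@complex.Re R \o f) \+ (@complex.Re R \o g)).
    exact: measurable_funD.
  by apply/funext => x /=; rewrite fctE/=; case: (f x) (g x) => [? ?] [].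
- rewrite (_ : _ \o _ = (@complex.Im R \o f) \+ (@complex.Im R \o g)).
    exact: measurable_funD.
  by apply/funext => x /=; rewrite fctE/=; case: (f x) (g x) => [? ?] [].
Qed.

Lemma cmeasurableM f g : cmeasurable f -> cmeasurable g -> cmeasurable (f \* g).
Proof.
move=> [rf jf] [rg jg]; split.
- rewrite (_ : _ \o _ = ((@complex.Re R \o f) \* (@complex.Re R \o g)) \-
      ((@complex.Im R \o f) \* (@complex.Im R \o g))).
    by apply: measurable_funB; exact: measurable_funM.
  by apply/funext => x /=; case: (f x) (g x) => [? ?] [].
- rewrite (_ : _ \o _ = ((@complex.Re R \o f) \* (@complex.Im R \o g)) \+
      ((@complex.Im R \o f) \* (@complex.Re R \o g))).
    by apply: measurable_funD; exact: measurable_funM.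
  by apply/funext => x /=; case: (f x) (g x) => [? ?] [].
Qed.

Lemma cmeasurable_cst (c : R[i]) : cmeasurable (fun=> c).
Proof. by split; exact: measurable_cst. Qed.

Lemma measurable_modulus f :
  cmeasurable f -> measurable_fun [set: R] (modulus \o f).
Proof.
move=> [rf jf].
rewrite (_ : _ \o _ = (@Num.sqrt R) \o
  (((@complex.Re R \o f) \* (@complex.Re R \o f)) \+
   ((@complex.Im R \o f) \* (@complex.Im R \o f)))); last first.
  by apply/funext => x /=; rewrite /modulus normc_def/= !expr2.
apply: measurableT_comp.
  by apply: continuous_measurable_fun => x; exact: sqrt_continuous.
by apply: measurable_funD; exact: measurable_funM.
Qed.

Lemma measurable_pow2 (h : R -> R) : measurable_fun [set: R] h ->
  measurable_fun [set: R] (fun x => (`|(EFin \o h) x| `^ 2)%E).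
Proof.
move=> mh; rewrite (_ : (fun _ => _) =
  EFin \o ((@powR R ^~ 2) \o (@Num.norm R R \o h))); last exact/funext.
apply/measurable_EFinP.
apply: (@measurableT_comp _ _ _ _ _ _ (@powR R ^~ 2)) => //.
exact: measurableT_comp.
Qed.

Lemma le_Lnorm2 (f g : R -> R) :
  measurable_fun [set: R] f -> measurable_fun [set: R] g ->
  (forall x, 0 <= f x <= g x) ->
  ('N[mu]_2%:E[EFin \o f] <= 'N[mu]_2%:E[EFin \o g])%E.
Proof.
move=> mf mg fg; rewrite unlock.
have ge0 (h : R -> R) : (0 <= \int[mu]_x (`|(EFin \o h) x| `^ 2))%E.
  by apply: integral_ge0 => x _; exact: poweR_ge0.
apply: gt0_ler_poweR; rewrite ?invr_ge0 ?in_itv/= ?leey ?andbT//.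
- exact: (ge0 f).
- exact: (ge0 g).
- apply: ge0_le_integral => //.
  + exact: measurable_pow2.
  + exact: measurable_pow2.
  + move=> x _ /=; have /andP[f0 fgx] := fg x.
    by rewrite lee_fin ge0_ler_powR// ?nnegrE// ger0_norm// ger0_norm// (le_trans f0).
Qed.

Definition eL2norm f : \bar R := 'N[mu]_2%:E[EFin \o (modulus \o f)]%E.

Lemma Lnorm_modulusD f g : cmeasurable f -> cmeasurable g ->
  (eL2norm (f + g)%R <= eL2norm f + eL2norm g)%E.
Proof.
move=> mf mg.
have [mmf mmg] := (measurable_modulus mf, measurable_modulus mg).
apply: le_trans (minkowski_EFin mu mmf mmg _); last by rewrite ler1n.
apply: le_Lnorm2.
- exact: measurable_modulus (cmeasurableD mf mg).
- exact: measurable_funD.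
- by move=> x /=; rewrite modulus_ge0 modulusD.
Qed.

Lemma Lnorm_modulusZ (a : R[i]) f : cmeasurable f -> (eL2norm f < +oo)%E ->
  eL2norm (a *: f) = ((modulus a)%:E * eL2norm f)%E.
Proof.
move=> mf lf.
have fP : modulus \o f \in Lfun mu 2%:E.
  by rewrite inE; apply/andP; split; apply/mem_set => //; exact: measurable_modulus.
have p1 : (1 <= 2%:E :> \bar R)%E by rewrite lee_fin ler1n.
have := LnormZ (Lfun_Sub p1 fP) (modulus a).
rewrite (ger0_norm (modulus_ge0 a)) => <-; congr (Lnorm mu).
by apply/funext => x /=; rewrite modulusM.
Qed.

Lemma sqint_submod_closed : submod_closed sqint.
Proof.
split.
  apply/asboolP; split; first exact: cmeasurable_cst.
  rewrite (_ : _ \o _ = cst 0); first by rewrite /finite_norm Lnorm0// ltry.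
  by apply/funext => x /=; rewrite /modulus normr0.
move=> a f g /asboolP[mf lf] /asboolP[mg lg].
have maf : cmeasurable (a *: f).
  exact: (cmeasurableM (cmeasurable_cst a) mf).
apply/asboolP; split; first exact: cmeasurableD.
apply: le_lt_trans (Lnorm_modulusD maf mg) _.
rewrite lte_add_pinfty// Lnorm_modulusZ// lte_mul_pinfty// lee_fin.
exact: modulus_ge0.
Qed.

HB.instance Definition _ :=
  GRing.isSubmodClosed.Build R[i] (R -> R[i]) sqint sqint_submod_closed.

Record sqfun := SqFun { sqfun_val :> R -> R[i]; _ : sqfun_val \in sqint }.
HB.instance Definition _ := [isSub for sqfun_val].
HB.instance Definition _ := [Choice of sqfun by <:].
HB.instance Definition _ := [SubChoice_isSubLmodule of sqfun by <:].

Definition aezero : {pred sqfun} := fun h : sqfun => `[< \forall x \ae mu, h x = 0 >].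

Lemma aezero_zmod_closed : zmod_closed aezero.
Proof.
split; first by apply/asboolP; exact: aeW.
move=> f g /asboolP f0 /asboolP g0; apply/asboolP.
have F := ae_filter_ringOfSetsType mu.
by apply: filterS2 f0 g0 => x /= f0 g0; rewrite !fctE f0 g0 subr0.
Qed.

HB.instance Definition _ :=
  GRing.isZmodClosed.Build sqfun aezero aezero_zmod_closed.

End SquareIntegrable.
Arguments sqint : clear implicits.
Arguments sqfun : clear implicits.
Arguments aezero : clear implicits.

Definition L2 (R : realType) : Type := Quotient.quot (aezero R).

Section HilbertSpace.
Context {R : realType}.
Local Notation mu := (@lebesgue_measure R).
Local Notation L2 := (L2 R).
Local Open Scope quotient_scope.

(* [L2 R] carries the L^2 norm; as a normed module over R[i] its norm is
   R[i]-valued. *)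
HB.instance Definition _ := GRing.Zmodule.on L2.
HB.instance Definition _ := EqQuotient.on L2.

(* A chosen representative of the class, determined only almost everywhere. *)
Definition L2fun (phi : L2) : R -> R[i] := repr phi.
Coercion L2fun : L2 >-> Funclass.

Lemma L2_eqP (f g : sqfun R) :
  \pi_L2 f = \pi_L2 g <-> \forall x \ae mu, f x = g x.
Proof.
have F := ae_filter_ringOfSetsType mu.
have E : (f - g \in aezero R) = (\pi_L2 f == \pi_L2 g).
  exact: Quotient.idealrBE.
split=> [/eqP|fg].
  rewrite -E => /asboolP; apply: filterS => x /= /eqP.
  by rewrite subr_eq0 => /eqP.
apply/eqP; rewrite -E; apply/asboolP; apply: filterS fg => x /= fgx.
by rewrite !fctE/= fgx subrr.
Qed.

Lemma L2fun_pi (f : sqfun R) : \forall x \ae mu, L2fun (\pi_L2 f) x = f x.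
Proof. by apply/L2_eqP; rewrite reprK. Qed.

Lemma sqfunP (f : sqfun R) : cmeasurable f /\ (eL2norm f < +oo)%E.
Proof. by case: f => f /= /asboolP. Qed.

Lemma ae_eq_eL2norm (f g : R -> R[i]) : cmeasurable f -> cmeasurable g ->
  (\forall x \ae mu, f x = g x) -> eL2norm f = eL2norm g.
Proof.
have F := ae_filter_ringOfSetsType mu.
move=> mf mg fg; rewrite /eL2norm unlock; congr poweR.
apply: ge0_ae_eq_integral => //.
- exact: (measurable_pow2 (measurable_modulus mf)).
- exact: (measurable_pow2 (measurable_modulus mg)).
- by move=> x _; exact: poweR_ge0.
- by move=> x _; exact: poweR_ge0.
- by apply: (filterS _ fg) => x /= ->.
Qed.

Definition L2scale (a : R[i]) (phi : L2) : L2 := \pi_L2 (a *: repr phi).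

Lemma L2scale_pi a (f : sqfun R) : L2scale a (\pi_L2 f) = \pi_L2 (a *: f).
Proof.
have F := ae_filter_ringOfSetsType mu.
by apply/L2_eqP; apply: filterS (L2fun_pi f) => x /= fx; rewrite !fctE -fx.
Qed.

Lemma L2_piD (f g : sqfun R) : \pi_L2 f + \pi_L2 g = \pi_L2 (f + g).
Proof. by rewrite !piE. Qed.

Lemma L2scaleA a b phi : L2scale a (L2scale b phi) = L2scale (a * b) phi.
Proof. by rewrite -[phi]reprK (L2scale_pi b) !L2scale_pi scalerA. Qed.

Lemma L2scale1 : left_id 1 L2scale.
Proof. by move=> phi; rewrite -[phi]reprK !L2scale_pi scale1r. Qed.

Lemma L2scaleDr : right_distributive L2scale +%R.
Proof.
move=> a phi psi; rewrite -[phi]reprK -[psi]reprK.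
by rewrite L2_piD !L2scale_pi L2_piD scalerDr.
Qed.

Lemma L2scaleDl phi : {morph L2scale^~ phi : a b / a + b}.
Proof.
by move=> a b /=; rewrite -[phi]reprK !L2scale_pi L2_piD scalerDl.
Qed.

HB.instance Definition _ := GRing.Zmodule_isLmodule.Build R[i] L2
  L2scaleA L2scale1 L2scaleDr L2scaleDl.

Definition L2norm (phi : L2) : R[i] := (fine (eL2norm phi))%:C.

Lemma L2norm_pi (f : sqfun R) : L2norm (\pi_L2 f) = (fine (eL2norm f))%:C.
Proof.
rewrite /L2norm (ae_eq_eL2norm _ _ (L2fun_pi f)) //.
  exact: (sqfunP _).1.
exact: (sqfunP _).1.
Qed.

Lemma eL2norm_fin_num (f : sqfun R) : eL2norm f \is a fin_num.
Proof. by rewrite ge0_fin_numE ?Lnorm_ge0//; exact: (sqfunP f).2. Qed.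

Lemma L2normD phi psi : L2norm (phi + psi) <= L2norm phi + L2norm psi.
Proof.
rewrite -[phi]reprK -[psi]reprK L2_piD !L2norm_pi -rmorphD lecR.
move: (repr phi) (repr psi) => f g.
rewrite -lee_fin EFinD !fineK ?eL2norm_fin_num//.
by apply: Lnorm_modulusD; exact: (sqfunP _).1.
Qed.

Lemma L2normZ a phi : L2norm (a *: phi) = `|a| * L2norm phi.
Proof.
rewrite -[phi]reprK [_ *: _]L2scale_pi !L2norm_pi -modulusE -rmorphM.
move: (repr phi) => f; congr (_%:C); apply: EFin_inj.
rewrite EFinM !fineK ?eL2norm_fin_num//.
by have [mf lf] := sqfunP f; exact: Lnorm_modulusZ.
Qed.

Lemma L2norm0_eq0 phi : L2norm phi = 0 -> phi = 0.
Proof.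
have F := ae_filter_ringOfSetsType mu.
rewrite -[phi]reprK L2norm_pi; move: (repr phi) => f [f0].
have {}f0 : eL2norm f = 0%E by rewrite -(fineK (eL2norm_fin_num f)) f0.
have -> : (0 : L2) = \pi_L2 0 by rewrite !piE.
apply/L2_eqP; have [mf _] := sqfunP f.
have mmf : measurable_fun [set: measurableTypeR R] (EFin \o (modulus \o f)).
  by apply/measurable_EFinP; exact: measurable_modulus mf.
have two_gt0 : (0 < 2%:E :> \bar R)%E by rewrite lte_fin.
have f0ae := Lnorm_eq0_eq0 mmf two_gt0 f0.
apply: (filterS _ f0ae).
move=> x /= /(_ I) [fx0]; apply/eqP; rewrite -normr_eq0 -modulusE fx0.
exact/eqP.
Qed.

HB.instance Definition _ :=
  Lmodule_isNormed.Build R[i] L2 L2normD L2normZ L2norm0_eq0.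

End HilbertSpace.

Section Exponential.
Context {R : realType}.
Local Notation mu := (@lebesgue_measure R).
Local Notation L2 := (L2 R).

Definition cintegral (f : R -> R[i]) : R[i] :=
  (\int[mu]_x complex.Re (f x)) +i* (\int[mu]_x complex.Im (f x)).

Definition dot (phi psi : L2) : R[i] :=
  cintegral (fun x => conjc (phi x) * psi x).

Definition unitary (V : L2 -> L2) : Prop :=
  [/\ linear V, bijective V &
      forall phi psi, dot (V phi) (V psi) = dot phi psi].

Definition unitary_group (U : R -> L2 -> L2) : Prop :=
  [/\ forall t, unitary (U t),
      U 0 = idfun,
      forall s t, U (s + t) = U s \o U t &
      forall phi, continuous (fun t => U t phi)].

(* Unbounded operators are represented by their graphs, so the closure of an
   operator is the topological closure of its graph. *)
Definition generator (U : R -> L2 -> L2) : set (L2 * L2) :=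
  [set z : L2 * L2 | t^-1%:C *: (U t z.1 - z.1) @[t --> 0^'] --> z.2].

(* For A self-adjoint, (e^{itA})_t is the unique strongly continuous unitary
   group with generator iA (Stone); [is_expi A V] says V = e^{iA}.  By the
   converse of Stone's theorem no V qualifies unless A is self-adjoint. *)
Definition is_expi (A : set (L2 * L2)) (V : L2 -> L2) : Prop :=
  exists U : R -> L2 -> L2,
    [/\ unitary_group U,
        generator U = [set (z.1, 'i%C *: z.2) | z in A] &
        V = U 1].

(* The default value idfun is only used when A is not self-adjoint. *)
Definition expi (A : set (L2 * L2)) : L2 -> L2 :=
  xget (idfun : L2 -> L2) [set V | is_expi A V].

End Exponential.

Section WeylOperators.
Context {R : realType}.
Local Notation mu := (@lebesgue_measure R).
Local Notation L2 := (L2 R).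
Implicit Types f : R -> R[i].

Definition smooth (g : R -> R) : Prop :=
  forall k x, derivable (derive1n k g) x 1.

Definition test_function f : Prop :=
  [/\ smooth (@complex.Re R \o f), smooth (@complex.Im R \o f) &
      compact (closure [set x | f x != 0])].

Definition position f : R -> R[i] := fun x => x%:C * f x.

Definition momentum f : R -> R[i] := fun x =>
  'i%C^-1 * (derive1 (@complex.Re R \o f) x +i* derive1 (@complex.Im R \o f) x).

Definition poly_position (P : {poly R}) f : R -> R[i] :=
  \sum_(i < size P) (P`_i)%:C *: iter i position f.

Definition weyl_generator (u : R) (P : {poly R}) : set (L2 * L2) :=
  [set z : L2 * L2 | exists f, [/\ test_function f,
     \forall x \ae mu, z.1 x = f x &
     \forall x \ae mu, z.2 x = (u%:C *: momentum f + poly_position P f) x]].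

Definition weyl (n : nat) (a : R * {poly_n.+1 R}) : L2 -> L2 :=
  expi (closure (weyl_generator a.1 a.2)).

End WeylOperators.

Section GroupLaw.
Context {R : realType} {n : nat}.
Local Notation mu := (@lebesgue_measure R).
Implicit Types P Q : {poly_n.+1 R}.

Lemma translate_subproof (u : R) P :
  P \Po ('X + u%:P) \is a poly_of_size n.+1.
Proof. by rewrite qualifE/= size_comp_poly2 ?size_XaddC// size_npoly. Qed.

Definition translate (u : R) P : {poly_n.+1 R} := NPoly (translate_subproof u P).

Definition oriented_integral (a b : R) (g : R -> R) : R :=
  if a <= b then \int[mu]_(y in `[a, b]) g y
  else - \int[mu]_(y in `[b, a]) g y.

(* The integral of the polynomial-valued map y |-> P(X + y) is taken
   coefficientwise. *)
Definition average (w : R) P : {poly_n.+1 R} :=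
  if w == 0 then P
  else w^-1 *:
    mk_npoly n.+1 (fun i => oriented_integral 0 w (fun y => (translate y P)`_i)).

(* Each [average w] is a bijection, so this partial inverse is its inverse. *)
Definition average_inv (w : R) : {poly_n.+1 R} -> {poly_n.+1 R} :=
  'pinv_(fun=> 0) setT (average w).

Definition weyl_mul (a b : R * {poly_n.+1 R}) : R * {poly_n.+1 R} :=
  (a.1 + b.1,
   average_inv (a.1 + b.1)
     (average a.1 a.2 + average b.1 (translate a.1 b.2))).

End GroupLaw.

(* Main.v *)
(* W(u, P) acts explicitly by (W(u, P) f)(x) = e^{i (T_u P)(x)} f(x + u), and
   with this formula the composition law reduces to the identities
   T_v S_u Q = S_u T_v Q and T_w (T_w^-1 S) = S; T_w is onto because T_w P - P has
   lower degree than P.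

   To obtain the formula, put U_t f(x) = e^{i theta_t(x)} f(x + tu) with
   theta_t = t T_{tu} P.  This is a group of unitaries since
   theta_{s+t}(x) = theta_s(x) + theta_t(x + su).  On a test function f the orbit
   t |-> U_t f is differentiable pointwise with derivative U_t (i(up + P(q)) f),
   so the real mean value theorem gives |U_t f - f| <= C |t| and
   |U_t f - f - t i(up + P(q)) f| <= C t^2 uniformly on a fixed compact set.
   Density of the test functions yields strong continuity, and since they are
   dense, invariant under U and contained in the domain of the generator, they
   form a core; thus the generator is i times the closure of up + P(q) on test
   functions.  Finally a strongly continuous isometry group is determined by its
   generator, because |U_t phi - U'_t phi| has zero derivative in t when phi lies
   in the common domain.  Riemann sums replace vector-valued integrals, and the
   completeness of L2 is never used. *)
Require Import Defs.
From HB Require Import structures.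
From mathcomp Require Import all_boot all_order all_algebra complex.
From mathcomp Require Import all_classical all_reals all_analysis.
From mathcomp Require Import measurable_realfun ring_quotient qpoly.
From mathcomp Require Import ring lra.
Set Implicit Arguments.
Unset Strict Implicit.
Unset Printing Implicit Defensive.
Import Order.TTheory GRing.Theory Num.Theory.
Import numFieldNormedType.Exports.

Local Open Scope classical_set_scope.
Local Open Scope ring_scope.
Local Open Scope complex_scope.

(** * Cancellation in abelian groups *)

Section ZmodCancel.
Context {V : zmodType}.
Implicit Types s t x y : V.

Lemma zmod_step s x y t : s = x + (t - y) -> s + y = x + t.
Proof. by move=> ->; rewrite addrA subrK. Qed.

Lemma zmod_hit s x t : s = t -> s + x = x + t.
Proof. by move=> ->; rewrite addrC. Qed.

Lemma zmod_last x t : 0 = t -> x = x + t.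
Proof. by move=> <-; rewrite addr0. Qed.

Lemma zmod_posP s x : s = - x + 0 -> s + x = 0.
Proof. by move=> ->; rewrite addr0 addNr. Qed.

Lemma zmod_negP s x : s = x + 0 -> s - x = 0.
Proof. by move=> ->; rewrite addr0 subrr. Qed.

End ZmodCancel.

(** In a goal [s + y = x + t], [x] is the term being looked for and [t], initially 0, accumulates
    the opposites of the terms already passed over. *)
Ltac zmod_search :=
  lazymatch goal with
  | |- ?s + ?y = ?x + ?t =>
      first [apply: zmod_hit | apply: zmod_step; zmod_search]
  | |- _ => apply: zmod_last
  end.

(* Decides equations between integer combinations of atoms in a Z-module: the
   last term of the flattened difference is cancelled against its opposite. *)
Ltac zmod :=
  apply/eqP; rewrite -subr_eq0; apply/eqP;
  rewrite ?(opprD, opprK, addrA, oppr0, addr0, add0r, sub0r);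
  lazymatch goal with
  | |- 0 = 0 => reflexivity
  | |- _ - ?x = 0 => apply: zmod_negP; zmod_search; zmod
  | |- _ + ?x = 0 => apply: zmod_posP; zmod_search; zmod
  end.

(** * Isometry groups and their generators *)

Section RealNorm.
Context {R : realType}.
Local Notation L2 := (L2 R).
Implicit Types (phi psi chi : L2) (t s e : R).

(** The norm of [L2] takes values in [R[i]]; its real part allows estimates in the ordered field
    [R]. *)
Definition nrm phi : R := complex.Re `|phi|.

Lemma ltr0c (t : R) : (0 < t%:C) = (0 < t).
Proof. exact: (ltcR 0 t). Qed.

Lemma nrmE phi : `|phi| = (nrm phi)%:C.
Proof. by rewrite /nrm; apply/esym/RRe_real/normr_real. Qed.

Lemma nrm_ge0 phi : 0 <= nrm phi.
Proof. by rewrite -ler0c -nrmE. Qed.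

Lemma nrmD phi psi : nrm (phi + psi) <= nrm phi + nrm psi.
Proof. by rewrite -lecR rmorphD/= -!nrmE ler_normD. Qed.

Lemma nrmN phi : nrm (- phi) = nrm phi.
Proof. by rewrite /nrm normrN. Qed.

Lemma nrmB phi psi : nrm (phi - psi) = nrm (psi - phi).
Proof. by rewrite /nrm distrC. Qed.

Lemma nrm_triangle psi phi chi :
  nrm (phi - chi) <= nrm (phi - psi) + nrm (psi - chi).
Proof. by rewrite -(subrKA psi) nrmD. Qed.

Lemma nrmZ t phi : nrm (t%:C *: phi) = `|t| * nrm phi.
Proof.
by apply: complexI; rewrite -nrmE normrZ nrmE rmorphM/= normc_def/= expr0n addr0 sqrtr_sqr.
Qed.

Lemma nrmZi phi : nrm ('i%C *: phi) = nrm phi.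
Proof. by apply: complexI; rewrite -!nrmE normrZ normc_def/= expr0n add0r expr1n sqrtr1 mul1r. Qed.

Lemma nrm0 : nrm 0 = 0.
Proof. by rewrite /nrm normr0. Qed.

Lemma nrm_eq0 phi : nrm phi = 0 -> phi = 0.
Proof. by move=> h; apply/eqP; rewrite -normr_eq0 nrmE h. Qed.


Lemma nrm_small_eq0 phi c : 0 <= c ->
  (forall e, 0 < e -> nrm phi <= c * e) -> phi = 0.
Proof.
move=> c0 H; apply: nrm_eq0; apply/eqP; rewrite eq_le nrm_ge0 andbT.
apply/ler_addgt0Pr => e e0; rewrite add0r.
(* Adding 1 keeps the denominator positive when [c = 0]. *)
apply: le_trans (H (e / (c + 1)) _) _; first by rewrite divr_gt0// ltr_wpDl.
by rewrite mulrCA ger_pMr// ler_pdivrMr ?mul1r ?lerDl// ltr_wpDl.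
Qed.

Lemma L2_cvgP (T : Type) (F : set_system T) {FF : Filter F} (f : T -> L2) phi :
  f @ F --> phi <-> forall e : R, 0 < e -> \forall t \near F, nrm (phi - f t) < e.
Proof.
split=> [/cvgrPdist_lt H e e0|H].
  have e0' : 0 < e%:C by rewrite ltr0c.
  by have := H _ e0'; apply: filterS => t; rewrite nrmE ltcR.
apply/cvgrPdist_lt => e e0.
have eR : e \is Num.real by rewrite gtr0_real.
rewrite -(RRe_real eR) ltr0c in e0 *.
by have := H _ e0; apply: filterS => t; rewrite nrmE ltcR.
Qed.

Lemma L2_closureP (A : set (L2 * L2)) (z : L2 * L2) :
  closure A z <-> forall e : R, 0 < e ->
    exists w, [/\ A w, nrm (w.1 - z.1) <= e & nrm (w.2 - z.2) <= e].
Proof.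
split=> [cA e e0|H B].
  have e0' : 0 < e%:C by rewrite ltr0c.
  have [] := cA (ball z.1 e%:C `*` ball z.2 e%:C).
    by exists (ball z.1 e%:C, ball z.2 e%:C) => //; split; exact: nbhsx_ballx.
  move=> w [Aw [/= w1 w2]]; exists w; split=> //; apply: ltW.
    by rewrite nrmB -ltcR -nrmE; move: w1; rewrite -ball_normE.
  by rewrite nrmB -ltcR -nrmE; move: w2; rewrite -ball_normE.
case=> -[B1 B2] /= [/nbhs_ballP[e1 /= e10 b1] /nbhs_ballP[e2 /= e20 b2]] sB.
have e1R : e1 \is Num.real by rewrite gtr0_real.
have e2R : e2 \is Num.real by rewrite gtr0_real.
rewrite -(RRe_real e1R) ltr0c in e10 b1.
rewrite -(RRe_real e2R) ltr0c in e20 b2.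
move: (complex.Re e1) (complex.Re e2) e10 b1 e20 b2 => {e1R e2R} {}e1 {}e2.
move=> e10 b1 e20 b2.
(* Halving the radius turns the non-strict bounds of the hypothesis into the strict ones of open
   balls. *)
have m0 : 0 < Num.min e1 e2 / 2 by rewrite divr_gt0// lt_min e10 e20.
have [w [Aw w1 w2]] := H _ m0.
have hm : Num.min e1 e2 / 2 < Num.min e1 e2.
  by rewrite ltr_pdivrMr// ltr_pMr ?ltr1n// lt_min e10 e20.
exists w; split=> //; apply: sB; split=> /=.
  apply: b1; rewrite -ball_normE/= nrmE ltcR nrmB (le_lt_trans w1)//.
  by rewrite (lt_le_trans hm)// ge_min lexx.
apply: b2; rewrite -ball_normE/= nrmE ltcR nrmB (le_lt_trans w2)//.
by rewrite (lt_le_trans hm)// ge_min lexx orbT.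
Qed.

End RealNorm.

Section IsometryGroup.
Context {R : realType}.
Local Notation L2 := (L2 R).
Implicit Types (phi psi chi : L2) (t s e : R).

(** The form of [unitary_group] on which the generator arguments run: the norm replaces the inner
    product, and continuity is asked at time 0, from where the group law carries it to every
    time. *)
Record isometry_group (U : R -> L2 -> L2) : Prop := IsometryGroup {
  isog_linear : forall t, linear (U t);
  isog_nrm : forall t phi, nrm (U t phi) = nrm phi;
  isog0 : forall phi, U 0 phi = phi;
  isogD : forall s t phi, U (s + t) phi = U s (U t phi);
  isog_cont : forall phi e, 0 < e ->
    exists2 d : R, 0 < d & forall t, `|t| <= d -> nrm (U t phi - phi) <= e }.

(* The generator in division-free form: U_t phi - phi - t chi = o(t). *)
Definition gen (U : R -> L2 -> L2) phi chi := forall e, 0 < e ->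
  exists2 d : R, 0 < d & forall t, `|t| <= d ->
    nrm (U t phi - phi - t%:C *: chi) <= e * `|t|.

Section Theory.
Variable U : R -> L2 -> L2.
Hypothesis UG : isometry_group U.

Let UD t phi psi : U t (phi + psi) = U t phi + U t psi.
Proof. by have /= := isog_linear UG t 1 phi psi; rewrite !scale1r. Qed.

Let U0 t : U t 0 = 0.
Proof. by apply: (addIr (U t 0)); rewrite -UD !add0r. Qed.

Let UZ t a phi : U t (a *: phi) = a *: U t phi.
Proof. by have /= := isog_linear UG t a phi 0; rewrite U0 !addr0. Qed.

Let UB t phi psi : U t (phi - psi) = U t phi - U t psi.
Proof. by rewrite UD -scaleN1r UZ scaleN1r. Qed.

(** Subtracting the two expansions at one small [t > 0] bounds the norm of [t (chi - chi')] by
    [2 e t]. *)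
Lemma gen_uniq phi chi chi' : gen U phi chi -> gen U phi chi' -> chi = chi'.
Proof.
move=> H H'; apply/eqP; rewrite -subr_eq0; apply/eqP.
apply: (@nrm_small_eq0 _ _ 2) => // e e0.
have [d d0 {}H] := H _ e0; have [d' d'0 {}H'] := H' _ e0.
pose t := Num.min d d'; have t0 : 0 < t by rewrite lt_min d0 d'0.
have {}H := H t; have {}H' := H' t; rewrite gtr0_norm// in H H'.
rewrite -(ler_pM2l t0) -{1}(gtr0_norm t0) -nrmZ scalerBr.
apply: le_trans (nrm_triangle (U t phi - phi) _ _) _.
rewrite nrmB mulrCA mulr2n mulrDl mul1r [t * _]mulrC.
by apply: lerD; [apply: H|apply: H']; rewrite ge_min lexx ?orbT.
Qed.

(** [U t] commutes with every [U s], so the remainder at [U t phi] is the isometric image of the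
    remainder at [phi]. *)
Lemma gen_group t phi chi : gen U phi chi -> gen U (U t phi) (U t chi).
Proof.
move=> H e e0; have [d d0 {}H] := H e e0; exists d => // s sd.
by rewrite -(isogD UG) [s + t]addrC (isogD UG) -UZ -!UB (isog_nrm UG) H.
Qed.

(* Telescoping t = N h writes U_t phi - phi - t chi as the sum over k < N of
   U_(kh) (U_h phi - phi - h chi) + h (U_(kh) chi - chi). *)
Lemma mean_value phi chi t e : 0 <= e -> gen U phi chi ->
  (forall s, `|s| <= `|t| -> nrm (U s chi - chi) <= e) ->
  nrm (U t phi - phi - t%:C *: chi) <= e * `|t|.
Proof.
(* The slack [r] pays for the [gen] remainders of the [N.+1] steps of length [h], each at most
   [r / (|t| + 1) * |h|]. *)
move=> e0 H small; apply/ler_addgt0Pr => r r0.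
have t1 : 0 < `|t| + 1 by rewrite ltr_wpDl.
have [d d0 {}H] := H _ (divr_gt0 r0 t1).
have [N Nd] : exists N : nat, `|t| / d <= N.+1%:R.
  exists (Num.Def.truncn (`|t| / d)); rewrite ltW//.
  by have /andP[] := Num.Theory.truncn_itv (divr_ge0 (normr_ge0 t) (ltW d0)).
pose h := t / N.+1%:R.
have N0 : 0 < N.+1%:R :> R by [].
have hd : `|h| <= d.
  rewrite normrM normfV (gtr0_norm N0) ler_pdivrMr// mulrC.
  by rewrite -ler_pdivrMr.
have tE : t = h * N.+1%:R by rewrite divfK// gt_eqF.
have key k : (k <= N.+1)%N ->
  nrm (U (h * k%:R) phi - phi - (h * k%:R)%:C *: chi) <=
  (`|h| * e + r / (`|t| + 1) * `|h|) * k%:R.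
  elim: k => [_|k IH kN].
    by rewrite !mulr0 (isog0 UG) subrr scale0r subr0 nrm0.
  have -> : U (h * k.+1%:R) phi - phi - (h * k.+1%:R)%:C *: chi =
     (U (h * k%:R) phi - phi - (h * k%:R)%:C *: chi) +
     (h%:C *: (U (h * k%:R) chi - chi) +
      U (h * k%:R) (U h phi - phi - h%:C *: chi)).
    rewrite -[k.+1%:R]natr1 mulrDr mulr1 (isogD UG) !UB UZ rmorphD/= scalerDl scalerBr; zmod.
  rewrite -[k.+1%:R]natr1 mulrDr mulr1.
  apply: le_trans (nrmD _ _) _; apply: lerD; first exact/IH/ltnW.
  apply: le_trans (nrmD _ _) _; rewrite nrmZ (isog_nrm UG); apply: lerD.
    rewrite ler_wpM2l// small// tE !normrM ler_wpM2l//.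
    by rewrite !ger0_norm// ler_nat ltnW.
  exact: H.
have := key N.+1 (leqnn _); rewrite -tE => /le_trans; apply.
have hE : `|h| * N.+1%:R = `|t| by rewrite -[X in _ * X](gtr0_norm N0) -normrM -tE.
have -> : (`|h| * e + r / (`|t| + 1) * `|h|) * N.+1%:R =
  e * `|t| + r / (`|t| + 1) * `|t| by rewrite -hE; ring.
rewrite lerD2l mulrAC ler_pdivrMr// ler_wpM2l ?ltW//.
by rewrite ltrDl.
Qed.

(** For an approximating pair [w], [mean_value] gives the bound [e |t|] on a range [|t| <= d] that
    depends on [chi] and [e] but not on [w]. Hence [w] may tend to [(phi, chi)] with [t] fixed. *)
Lemma gen_closed phi chi :
  (forall e, 0 < e -> exists w : L2 * L2,
     [/\ gen U w.1 w.2, nrm (w.1 - phi) <= e & nrm (w.2 - chi) <= e]) ->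
  gen U phi chi.
Proof.
move=> H e e0; have e40 : 0 < e / 4 by rewrite divr_gt0.
have [d d0 small] := isog_cont UG chi e40.
exists d => // t td; apply/ler_addgt0Pr => r r0.
(* Replacing [w] by [(phi, chi)] costs at most [(2 + |t|)] times the distance, which [r / (3 + |t|)]
   keeps below [r]. *)
have t3 : 0 < 3 + `|t| by rewrite ltr_wpDr.
have [] := H (Num.min (r / (3 + `|t|)) (e / 4)).
  by rewrite lt_min e40 divr_gt0.
move=> w [gw]; rewrite !le_min => /andP[w1 _] /andP[w2 w2'].
have mv : nrm (U t w.1 - w.1 - t%:C *: w.2) <= e * `|t|.
  apply: mean_value => //; first exact: ltW.
  move=> s st; apply: le_trans (nrm_triangle (U s chi) _ _) _.
  rewrite -UB (isog_nrm UG).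
  apply: le_trans (lerD w2' (nrm_triangle chi _ _)) _.
  rewrite [nrm (chi - _)]nrmB.
  apply: le_trans (lerD (lexx _) (lerD (small s (le_trans st td)) w2')) _.
  lra.
have -> : U t phi - phi - t%:C *: chi = (U t w.1 - w.1 - t%:C *: w.2) +
    (U t (phi - w.1) - (phi - w.1) + t%:C *: (w.2 - chi)).
  by rewrite UB scalerBr; zmod.
have h1 := lerD (nrmD (U t (phi - w.1)) (- (phi - w.1))) (lexx (nrm (t%:C *: (w.2 - chi)))).
have h2 := nrmD (U t (phi - w.1) - (phi - w.1)) (t%:C *: (w.2 - chi)).
rewrite nrmN (isog_nrm UG) nrmZ in h1 h2.
apply: le_trans (nrmD _ _) _; apply: lerD => //.
apply: le_trans h2 (le_trans h1 _).
have h3 : `|t| * nrm (w.2 - chi) <= `|t| * (r / (3 + `|t|)) by rewrite ler_wpM2l// (le_trans w2).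
have h4 : (2 + `|t|) * (r / (3 + `|t|)) <= r.
  by rewrite mulrCA ger_pMr// ler_pdivrMr// mul1r; lra.
rewrite [nrm (phi - w.1)]nrmB mulrDl in h1 h4 *; lra.
Qed.

(* The witness is the Riemann sum N^-1 sum_(k < N) U_(kh) f with N h = t, where
   f is close to phi: the mean value over [0, t] of U_s f is close to phi, and
   its image under the generator is close to t^-1 (U_t f - f). *)
Lemma gen_core (A : set (L2 * L2)) :
    (forall w, A w -> gen U w.1 w.2) ->
    (forall a w w', A w -> A w' ->
       A (a%:C *: w.1 + w'.1, a%:C *: w.2 + w'.2)) ->
    (forall t w, A w -> exists chi, A (U t w.1, chi)) ->
    (forall phi e, 0 < e -> exists2 w, A w & nrm (w.1 - phi) <= e) ->
  forall phi chi, gen U phi chi -> forall e, 0 < e ->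
    exists w, [/\ A w, nrm (w.1 - phi) <= e & nrm (w.2 - chi) <= e].
Proof.
move=> Agen Alin Ainv Adense phi chi H e e0.
have e40 : 0 < e / 4 by rewrite divr_gt0.
have [d d0 {}H] := H _ e40; have [d' d'0 small] := isog_cont UG phi e40.
pose t := Num.min d d'; have t0 : 0 < t by rewrite lt_min d0 d'0.
have {}H : nrm (U t phi - phi - t%:C *: chi) <= e / 4 * t.
  by have := H t; rewrite gtr0_norm//; apply; rewrite ge_min lexx.
have {}small s : 0 <= s -> s <= t -> nrm (U s phi - phi) <= e / 4.
  by move=> s0; rewrite le_min => /andP[_ st]; apply: small; rewrite ger0_norm.
(* The first bound serves the average of the orbit of [f]; the second is proportional to [t] because
   the image under the generator is later divided by [t]. *)
have m0 : 0 < Num.min (e / 4) (e / 4 * t / 2).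
  by rewrite lt_min e40 divr_gt0// mulr_gt0.
have [[f g] Af /=] := Adense phi _ m0; rewrite le_min => /andP[fphi fphit].
(* Invariance of [A] supplies only some second component; uniqueness of the generator identifies it
   as [U s g]. *)
have AU s : A (U s f, U s g).
  have [g' Ag'] := Ainv s _ Af.
  by rewrite (gen_uniq (gen_group s (Agen _ Af)) (Agen _ Ag')).
have [d'' d''0 gf] := Agen _ Af _ e40; rewrite /= in gf.
have [N Nd] : exists N : nat, t / d'' <= N.+1%:R.
  exists (Num.Def.truncn (t / d'')); rewrite ltW//.
  by have /andP[] := Num.Theory.truncn_itv (divr_ge0 (ltW t0) (ltW d''0)).
pose h := t / N.+1%:R.
have N0 : 0 < N.+1%:R :> R by [].
have h0 : 0 < h by rewrite divr_gt0.
have hd : `|h| <= d''.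
  by rewrite gtr0_norm// ler_pdivrMr// mulrC -ler_pdivrMr.
have tE : t = h * N.+1%:R by rewrite divfK// gt_eqF.
pose S n psi := \sum_(k < n) U (h * k%:R) psi.
have SS n psi : S n.+1 psi = S n psi + U (h * n%:R) psi by rewrite /S big_ord_recr.
have AS n : A (S n.+1 f, S n.+1 g).
  elim: n => [|n IH]; first by rewrite /S !big_ord1.
  by have /= := Alin 1 _ _ IH (AU (h * n.+1%:R)); rewrite !scale1r -!SS.
have S1 n : (n <= N.+1)%N -> nrm (S n f - n%:R%:C *: phi) <= e / 2 * n%:R.
  elim: n => [_|n IH nN]; first by rewrite /S big_ord0 scale0r subrr nrm0 mulr0.
  have -> : S n.+1 f - n.+1%:R%:C *: phi = (S n f - n%:R%:C *: phi) +
     (U (h * n%:R) (f - phi) + (U (h * n%:R) phi - phi)).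
    by rewrite SS -[n.+1%:R]natr1 rmorphD/= scalerDl scale1r UB; zmod.
  rewrite -[n.+1%:R]natr1 mulrDr mulr1; apply: le_trans (nrmD _ _) _.
  apply: lerD; first exact/IH/ltnW.
  apply: le_trans (nrmD _ _) _; rewrite (isog_nrm UG).
  have : nrm (U (h * n%:R) phi - phi) <= e / 4.
    apply: small; first by rewrite mulr_ge0// ltW.
    by rewrite tE ler_pM2l// ler_nat ltnW.
  lra.
have S2 n : nrm (h%:C *: S n g - (U (h * n%:R) f - f)) <= e / 4 * h * n%:R.
  elim: n => [|n IH].
    by rewrite /S big_ord0 scaler0 !mulr0 (isog0 UG) !subrr nrm0.
  have -> : h%:C *: S n.+1 g - (U (h * n.+1%:R) f - f) =
      (h%:C *: S n g - (U (h * n%:R) f - f)) -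
      U (h * n%:R) (U h f - f - h%:C *: g).
    by rewrite SS -[n.+1%:R]natr1 mulrDr mulr1 (isogD UG) !UB UZ scalerDr; zmod.
  rewrite -[n.+1%:R]natr1 mulrDr mulr1; apply: le_trans (nrmD _ _) _; apply: lerD => //.
  by rewrite nrmN (isog_nrm UG); have := gf h hd; rewrite (gtr0_norm h0).
exists (N.+1%:R^-1%:C *: S N.+1 f, N.+1%:R^-1%:C *: S N.+1 g); split => /=.
(* [Alin] forms [a w + w'], so a pure multiple needs the zero pair, obtained here as [- w + w]. *)
- have := Alin N.+1%:R^-1 _ _ (AS N) (Alin (-1) _ _ (AS N) (AS N)).
  by rewrite /= rmorphN1 !scaleN1r !addNr !addr0.
- rewrite -(ler_pM2l N0) -{1}(gtr0_norm N0) -nrmZ scalerBr scalerA -rmorphM/=.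
  rewrite divff ?gt_eqF// scale1r mulrC; apply: le_trans (S1 _ (leqnn _)) _.
  by rewrite ler_wpM2r//; lra.
- rewrite -(ler_pM2l t0) -{1}(gtr0_norm t0) -nrmZ scalerBr scalerA -rmorphM/=.
  rewrite -/h.
  have -> : h%:C *: S N.+1 g - t%:C *: chi =
      (h%:C *: S N.+1 g - (U (h * N.+1%:R) f - f)) +
      (U t (f - phi) - (f - phi) + (U t phi - phi - t%:C *: chi)).
    by rewrite -tE UB; zmod.
  have := S2 N.+1; rewrite -mulrA -tE => h2.
  have h1 := nrmD (U t (f - phi)) (- (f - phi)).
  rewrite nrmN (isog_nrm UG) in h1.
  apply: le_trans (nrmD _ _) _; apply: le_trans (lerD h2 (nrmD _ _)) _.
  have et0 : 0 < e * t by rewrite mulr_gt0.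
  lra.
Qed.

End Theory.

(** Division-free criterion in the shape of [gen]; it yields the zero derivative in the uniqueness
    of groups and the derivative of [flat] at 0. *)
Lemma is_derive_small (f : R -> R) x l :
    (forall e, 0 < e -> exists2 d : R, 0 < d & forall t, `|t| <= d ->
       `|f (x + t) - f x - t * l| <= e * `|t|) ->
  is_derive x 1 f l.
Proof.
move=> H.
have cl : h^-1 *: ((f \o shift x) (h *: 1) - f x) @[h --> 0^'] --> l.
  apply/cvgrPdist_le => e e0; have [d d0 {}H] := H e e0.
  near=> t; have t0 : t != 0 by near: t; exact: nbhs_dnbhs_neq.
  have td : `|t| <= d by near: t; exact: dnbhs0_le.
  rewrite /= distrC -(ler_pM2r (_ : 0 < `|t|)) ?normr_gt0// -normrM.
  have := H t td; congr (`|_| <= _); rewrite [_ *: 1]mulr1 addrC [t + x]addrC.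
  by rewrite /GRing.scale/= mulrDl mulrAC mulVf// mul1r mulNr addrC [l * t]mulrC.
apply: DeriveDef; first by apply/cvg_ex; exists l.
exact: cvg_lim.
Unshelve. all: by end_near. Qed.

(* nrm (U_t phi - U'_t phi) has zero derivative in t: for b = U'_t phi, the
   vectors U_k b and U'_k b differ by o(k). *)
Lemma isometry_group_unique (U U' : R -> L2 -> L2) :
    isometry_group U -> isometry_group U' ->
    (forall phi chi, gen U phi chi <-> gen U' phi chi) ->
    (forall phi e, 0 < e -> exists psi chi, gen U psi chi /\ nrm (psi - phi) <= e) ->
  U = U'.
Proof.
move=> UG UG' UU' dense.
have nB V t phi psi : isometry_group V -> V t phi - V t psi = V t (phi - psi).
  move=> VG; have := isog_linear VG t (-1) psi phi.
  by rewrite !scaleN1r addrC => <-; rewrite addrC.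
have key phi chi t : gen U phi chi -> U t phi = U' t phi.
  move=> H; apply/eqP; rewrite -subr_eq0; apply/eqP/nrm_eq0.
  transitivity (nrm (U 0 phi - U' 0 phi)); last first.
    by rewrite (isog0 UG) (isog0 UG') subrr nrm0.
  apply: (@is_derive_0_is_cst _ (fun t => nrm (U t phi - U' t phi))) => {}t.
  apply: is_derive_small => e e0.
  have H' : gen U' (U' t phi) (U' t chi) by apply: gen_group => //; exact/UU'.
  have [d d0 {}H] := (UU' _ _).2 H' _ (divr_gt0 e0 (ltr0n _ 2)).
  have [d' d'0 {}H'] := H' _ (divr_gt0 e0 (ltr0n _ 2)).
  exists (Num.min d d'); first by rewrite lt_min d0.
  move=> k; rewrite le_min => /andP[kd kd'].
  rewrite mulr0 subr0 [t + k]addrC (isogD UG) (isogD UG').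
  rewrite -[nrm (U t phi - _)](isog_nrm UG k) -nB//.
  (* With [b = U' t phi], the norm at time [t] is that of [U k (U t phi) - U k b], as [U k] is an
     isometry. The reverse triangle inequality leaves the distance from [U k b] to [U' k b]. *)
  apply: (@le_trans _ _ (nrm (U k (U' t phi) - U' k (U' t phi)))).
    have h1 := nrm_triangle (U' k (U' t phi)) (U k (U t phi)) (U k (U' t phi)).
    have h2 := nrm_triangle (U k (U' t phi)) (U k (U t phi)) (U' k (U' t phi)).
    rewrite [nrm (U' k _ - _)]nrmB in h1.
    by rewrite ler_norml; apply/andP; split; lra.
  apply: le_trans (nrm_triangle (U' t phi + k%:C *: U' t chi) _ _) _.
  rewrite [X in _ + X]nrmB !opprD !addrA.
  by have := H _ kd; have := H' _ kd'; lra.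
apply/funext => t; apply/funext => phi.
apply/eqP; rewrite -subr_eq0; apply/eqP; apply: (@nrm_small_eq0 _ _ 2) => // e e0.
have [psi [chi [H psie]]] := dense phi e e0.
apply: le_trans (nrm_triangle (U t psi) _ _) _; rewrite {2}(key _ _ _ H) !nB//.
by rewrite (isog_nrm UG) (isog_nrm UG') nrmB mulr2n mulrDl mul1r lerD.
Qed.

End IsometryGroup.

(** * Translation invariance and the space L2 *)

Section Translation.
Context {R : realType}.
Local Notation mu := (@lebesgue_measure R).

Lemma measurable_shift (a : R) :
  measurable_fun [set: measurableTypeR R] (fun x : measurableTypeR R => x + a : measurableTypeR R).
Proof. exact: measurable_funD. Qed.

(** The pushforward under the translation agrees with Lebesgue measure on half-open intervals, which
    determine the measure. *)
Lemma lebesgue_measure_shift (a : R) (A : set (measurableTypeR R)) : measurable A ->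
  mu ((fun x : R => x + a) @^-1` A) = mu A.
Proof.
move=> mA; have := measurable_shift a => ms.
apply/esym; apply: (@lebesgue_measure_unique R
  (pushforward mu (fun x : measurableTypeR R => x + a : measurableTypeR R))) => //.
move=> _ [[b c]] _ <-; rewrite [LHS]/= [RHS]/=.
transitivity (mu `]b - a, c - a]%classic); last first.
  by congr (mu _); apply/seteqP; split=> x /=; rewrite !in_itv/= ltrBlDr lerBrDr.
rewrite !lebesgue_measure_itv/= !lte_fin ltrD2r.
by case: ifPn => // _; rewrite -!EFinB; congr EFin; ring.
Qed.

Lemma ge0_integral_shift (a : R) (f : R -> \bar R) :
  measurable_fun [set: R] f -> (forall x, 0 <= f x)%E ->
  (\int[mu]_x f (x + a)%R = \int[mu]_x f x)%E.
Proof.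
move=> mf f0; have ms := measurable_shift a.
have := @ge0_integral_pushforward _ _ _ _ R _ ms mu setT f measurableT mf (fun x _ => f0 x).
rewrite preimage_setT => <-.
by apply: eq_measure_integral => //= A mA _; exact: lebesgue_measure_shift.
Qed.

Lemma integral_shift (a : R) (f : R -> \bar R) : measurable_fun [set: R] f ->
  (\int[mu]_x f (x + a)%R = \int[mu]_x f x)%E.
Proof.
move=> mf; rewrite integralE [RHS]integralE; congr (_ - _)%E.
  rewrite -(ge0_integral_shift a (measurable_funepos mf) (funepos_ge0 f)).
  by apply: eq_integral => x _; rewrite !funeposE.
rewrite -(ge0_integral_shift a (measurable_funeneg mf) (funeneg_ge0 f)).
by apply: eq_integral => x _; rewrite !funenegE.
Qed.

Lemma ae_shift (a : R) (P : R -> Prop) :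
  (\forall x \ae mu, P x) -> \forall x \ae mu, P (x + a).
Proof.
move=> [A [mA A0 sA]]; exists ((fun x => x + a) @^-1` A); split.
- by rewrite -[X in measurable X]setTI; exact: measurable_shift.
- by rewrite lebesgue_measure_shift.
- by move=> x /= Px; exact: sA.
Qed.

End Translation.

(** * Norm, inner product and almost everywhere representatives in L2 *)

Section L2Facts.
Context {R : realType}.
Local Notation mu := (@lebesgue_measure R).
Local Notation L2 := (L2 R).
Local Open Scope quotient_scope.
Implicit Types (phi psi chi : L2) (z w : R[i]).

Lemma modulus_sqr z : modulus z ^+ 2 = complex.Re z ^+ 2 + complex.Im z ^+ 2.
Proof. by rewrite /modulus normc_def sqr_sqrtr// addr_ge0// sqr_ge0. Qed.

Lemma eL2norm_sqr (f : R -> R[i]) :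
  (eL2norm f `^ 2 = \int[mu]_x ((modulus (f x)) ^+ 2)%:E)%E.
Proof.
rewrite /eL2norm poweR_Lnorm//; apply: eq_integral => x _ /=.
by rewrite ger0_norm ?modulus_ge0// -powR_mulrn ?modulus_ge0.
Qed.

Lemma nrm_pi_sqr (f : sqfun R) :
  ((nrm (\pi_L2 f : L2)) ^+ 2)%:E = (\int[mu]_x ((modulus (f x)) ^+ 2)%:E)%E.
Proof.
rewrite -eL2norm_sqr /nrm [`|_|]L2norm_pi/= -powR_mulrn.
  by rewrite -poweR_EFin fineK// eL2norm_fin_num.
by rewrite fine_ge0// Lnorm_ge0.
Qed.

Lemma nrm_sqr phi :
  ((nrm phi) ^+ 2)%:E = (\int[mu]_x ((modulus (phi x)) ^+ 2)%:E)%E.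
Proof. by rewrite -nrm_pi_sqr reprK. Qed.

Lemma dot_self phi : dot phi phi = (nrm phi ^+ 2)%:C.
Proof.
rewrite /dot /cintegral; congr (_ +i* _).
  rewrite -[RHS]/(fine (_ ^+ 2)%:E) nrm_sqr /Rintegral; congr fine.
  apply: eq_integral => x _; congr EFin; rewrite modulus_sqr.
  by case: (L2fun phi x) => a b /=; ring.
rewrite (_ : (fun _ => _) = cst 0); last first.
  by apply/funext => x /=; case: (L2fun phi x) => a b /=; ring.
by rewrite /Rintegral integral0.
Qed.

Lemma L2_ext phi psi : (\forall x \ae mu, phi x = psi x) -> phi = psi.
Proof. by move=> h; rewrite -[phi]reprK -[psi]reprK; apply/L2_eqP. Qed.

Lemma L2funD phi psi : \forall x \ae mu, L2fun (phi + psi) x = phi x + psi x.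
Proof.
have F := ae_filter_ringOfSetsType mu.
have := L2fun_pi (repr phi + repr psi); rewrite -L2_piD !reprK.
by apply: filterS => x ->.
Qed.

Lemma L2funZ (a : R[i]) phi : \forall x \ae mu, L2fun (a *: phi) x = a * phi x.
Proof.
have F := ae_filter_ringOfSetsType mu.
have := L2fun_pi (a *: repr phi); rewrite -L2scale_pi reprK.
by apply: filterS => x ->.
Qed.

Lemma L2funN phi : \forall x \ae mu, L2fun (- phi) x = - phi x.
Proof.
have F := ae_filter_ringOfSetsType mu.
by rewrite -scaleN1r; apply: filterS (L2funZ (-1) phi) => x ->; rewrite mulN1r.
Qed.

Lemma cmeasurable_L2 phi : cmeasurable phi.
Proof. exact: (sqfunP (repr phi)).1. Qed.

Lemma cmeasurable_conj (f : R -> R[i]) : cmeasurable f -> cmeasurable (conjc \o f).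
Proof.
move=> [mr mi]; split; first by rewrite (_ : _ \o _ = complex.Re (R:=R) \o f)//;
  apply/funext => x /=; case: (f x).
rewrite (_ : _ \o _ = \- (complex.Im (R:=R) \o f)); first exact: measurable_funN.
by apply/funext => x /=; case: (f x).
Qed.

Lemma eq_cintegral_ae (f g : R -> R[i]) : cmeasurable f -> cmeasurable g ->
  (\forall x \ae mu, f x = g x) -> cintegral f = cintegral g.
Proof.
have F := ae_filter_ringOfSetsType mu.
move=> [mfr mfi] [mgr mgi] fg; rewrite /cintegral /Rintegral; congr (fine _ +i* fine _).
  by apply: ae_eq_integral => //; [exact/measurable_EFinP|exact/measurable_EFinP|
    apply: filterS fg => x -> _].
by apply: ae_eq_integral => //; [exact/measurable_EFinP|exact/measurable_EFinP|
  apply: filterS fg => x -> _].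
Qed.

Lemma cintegral_shift (a : R) (f : R -> R[i]) : cmeasurable f ->
  cintegral (fun x => f (x + a)) = cintegral f.
Proof.
move=> [mfr mfi]; rewrite /cintegral /Rintegral; congr (fine _ +i* fine _).
  by rewrite -(integral_shift a (f := fun x => (complex.Re (f x))%:E))//; exact/measurable_EFinP.
by rewrite -(integral_shift a (f := fun x => (complex.Im (f x))%:E))//; exact/measurable_EFinP.
Qed.

End L2Facts.

(** * Unitary groups as isometry groups *)

Section UnitaryGroups.
Context {R : realType}.
Local Notation L2 := (L2 R).
Variable U : R -> L2 -> L2.

Lemma unitary_group_isometry : unitary_group U -> isometry_group U.
Proof.
move=> [Uu U0 UD Uc]; split.
- by move=> t; case: (Uu t).
- move=> t phi; apply/eqP; rewrite -(eqrXn2 (_ : 0 < 2)%N) ?nrm_ge0//.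
  apply/eqP/complexI; rewrite -!dot_self.
  by case: (Uu t).
- by move=> phi; rewrite U0.
- by move=> s t phi; rewrite UD.
- move=> phi e e0; have /L2_cvgP/(_ _ e0) := Uc phi 0.
  rewrite U0/= => /nbhs_ballP[d /= d0 H]; exists (d / 2); first by rewrite divr_gt0.
  move=> t td; rewrite nrmB ltW//; apply: H.
  by rewrite /ball/= sub0r normrN (le_lt_trans td)// ltr_pdivrMr// ltr_pMr// ltr1n.
Qed.

Lemma isometry_group_unitary : isometry_group U ->
  (forall t phi psi, dot (U t phi) (U t psi) = dot phi psi) -> unitary_group U.
Proof.
move=> UG Ud; split.
- move=> t; split; [exact: isog_linear UG t| |exact: Ud].
  by exists (U (- t)) => phi; rewrite -(isogD UG) ?addNr ?subrr (isog0 UG).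
- by apply/funext => phi; rewrite (isog0 UG).
- by move=> s t; apply/funext => phi; rewrite (isogD UG).
- move=> phi t; apply/L2_cvgP => e e0.
  have e20 : 0 < e / 2 by rewrite divr_gt0.
  have [d d0 H] := isog_cont UG phi e20.
  apply/nbhs_ballP; exists d => //= s; rewrite /ball/= => ts.
  rewrite nrmB -(isog_nrm UG (- t)).
  have -> : U (- t) (U s phi - U t phi) = U (s - t) phi - phi.
    have := isog_linear UG (- t) (-1) (U t phi) (U s phi).
    by rewrite !scaleN1r [- U t phi + _]addrC => ->; rewrite -!(isogD UG) addNr
      (isog0 UG) addrC [- t + s]addrC.
  apply: le_lt_trans (H _ _) _; first by rewrite distrC ltW.
  by rewrite ltr_pdivrMr// ltr_pMr// ltr1n.
Qed.

Lemma generatorP phi chi : isometry_group U ->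
  generator U (phi, chi) <-> gen U phi chi.
Proof.
move=> UG; split=> [H e e0|H].
  have /L2_cvgP/(_ _ e0) := H; move=> /nbhs_ballP[d /= d0 {}H].
  exists (d / 2); first by rewrite divr_gt0.
  move=> t td; have [->|t0] := eqVneq t 0.
    by rewrite (isog0 UG) subrr scale0r subrr nrm0 normr0 mulr0.
  have td' : ball 0 d t.
    by rewrite /ball/= sub0r normrN (le_lt_trans td)// ltr_pdivrMr// ltr_pMr// ltr1n.
  have := ltW (H t td' t0); rewrite nrmB -(ler_pM2l (_ : 0 < `|t|)) ?normr_gt0//.
  by rewrite -nrmZ scalerBr scalerA -rmorphM/= mulfV// scale1r mulrC.
apply/L2_cvgP => e e0.
have [d d0 {}H] := H (e / 2) (divr_gt0 e0 (ltr0n _ 2)).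
apply/nbhs_ballP; exists d => //= t; rewrite /ball/= sub0r normrN => td t0.
rewrite nrmB; have := H t (ltW td).
have -> : U t phi - phi - t%:C *: chi = t%:C *: (t^-1%:C *: (U t phi - phi) - chi).
  by rewrite scalerBr scalerA -rmorphM/= mulfV// scale1r.
rewrite nrmZ mulrC ler_pM2r ?normr_gt0// => /le_lt_trans; apply.
by rewrite ltr_pdivrMr// ltr_pMr// ltr1n.
Qed.

End UnitaryGroups.

(** * Smooth functions *)

Section Smooth.
Context {R : realType}.
Implicit Types (f g h : R -> R) (x a b c : R) (p : {poly R}).

(** Peeling off one derivative at a time lets closure under sums, products and composition go by
    induction on [k], for all functions at once. The index is shifted: [Ck k] means [k.+1] times
    differentiable. *)
Fixpoint Ck (k : nat) f : Prop :=
  (forall x, derivable f x 1) /\ (if k is j.+1 then Ck j (f^`())%classic else True).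

Lemma smoothP f : smooth f <-> forall k, Ck k f.
Proof.
split=> [sf k|cf k].
  elim: k f sf => [|k IH] f sf; split=> //; first exact: (sf 0%N).
    exact: (sf 0%N).
  by apply: IH => j x; have := sf j.+1 x; rewrite derive1Sn.
move: (cf k); elim: k f {cf} => [|k IH] f [df ck] x; first exact: df.
rewrite derive1Sn; exact: IH.
Qed.

Lemma is_derive_derive1 f x l : is_derive x 1 f l -> (f^`())%classic x = l.
Proof. by move=> [_ <-]; rewrite derive1E. Qed.

Lemma Ck_is_derive k f g : (forall x, is_derive x (1 : R) f (g x)) -> Ck k g ->
  Ck k.+1 f.
Proof.
move=> fg cg; split=> [x|]; first by case: (fg x).
by rewrite (_ : (f^`())%classic = g)//; apply/funext => x; exact: is_derive_derive1.
Qed.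

Lemma Ck_derivable k f : Ck k f -> forall x, derivable f x 1.
Proof. by case: k => [|k] []. Qed.

Lemma Ck_derive k f : Ck k f -> forall x, is_derive x (1 : R) f ((f^`())%classic x).
Proof. by move=> /Ck_derivable df x; rewrite derive1E; exact: derivableP. Qed.

Lemma CkW k f : Ck k.+1 f -> Ck k f.
Proof.
elim: k f => [|k IH] f [df ck]; split=> //.
exact: IH.
Qed.

Lemma Ck_cst k c : Ck k (cst c).
Proof.
elim: k c => [|k IH] c; first by split=> // x; exact: derivable_cst.
exact: Ck_is_derive (IH 0).
Qed.

Lemma CkD k f g : Ck k f -> Ck k g -> Ck k (f \+ g).
Proof.
elim: k f g => [|k IH] f g cf cg.
  by split=> // x; apply: derivableD; [exact: Ck_derivable cf _|exact: Ck_derivable cg _].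
apply: (@Ck_is_derive _ _ ((f^`())%classic \+ (g^`())%classic)); last first.
  by apply: IH; [case: cf|case: cg].
by move=> x; apply: (is_deriveD (Ck_derive cf x) (Ck_derive cg x)).
Qed.

Lemma CkM k f g : Ck k f -> Ck k g -> Ck k (f \* g).
Proof.
elim: k f g => [|k IH] f g cf cg.
  by split=> // x; apply: derivableM; [exact: Ck_derivable cf _|exact: Ck_derivable cg _].
apply: (@Ck_is_derive _ _ (f \* (g^`())%classic \+ g \* (f^`())%classic)).
  by move=> x; apply: (is_deriveM (Ck_derive cf x) (Ck_derive cg x)).
by apply: CkD; apply: IH; by [exact: CkW|case: cf|case: cg].
Qed.

Lemma Ck_horner k p : Ck k (horner p).
Proof.
by elim: k p => [|k IH] p; [split=> // x; exact: derivable_horner|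
  apply: Ck_is_derive (IH p^`()) => x].
Qed.

Lemma is_derive_affine f c b x l : is_derive (c * x + b) (1 : R) f l ->
  is_derive x (1 : R) (fun y => f (c * y + b)) (c * l).
Proof.
move=> fl; rewrite mulrC; apply: (@is_derive1_comp _ f (fun y => c * y + b)).
have := is_derive_poly (c *: 'X + b%:P) x.
rewrite derivD derivZ derivX derivC addr0 hornerZ hornerC mulr1.
by rewrite (_ : horner _ = fun y => c * y + b)//; apply/funext => y; rewrite !hornerE.
Qed.

Lemma Ck_affine k f c b : Ck k f -> Ck k (fun y => f (c * y + b)).
Proof.
elim: k f => [|k IH] f cf.
  split=> // x; have [] // := @is_derive_affine f c b x _ (Ck_derive cf _).
apply: (@Ck_is_derive _ _ (cst c \* (fun y => (f^`())%classic (c * y + b)))).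
  by move=> x; apply: is_derive_affine; exact: Ck_derive cf _.
by apply: CkM; [exact: Ck_cst|apply: IH; case: cf].
Qed.

(** The two claims share one induction because differentiation exchanges cosine and sine. *)
Lemma Ck_cos_sin k f : Ck k f -> Ck k (cos \o f) /\ Ck k (sin \o f).
Proof.
have dc x : Ck k f -> is_derive x (1 : R) (cos \o f) (- sin (f x) * (f^`())%classic x).
  by move=> cf; apply: is_derive1_comp; exact: Ck_derive cf _.
have ds x : Ck k f -> is_derive x (1 : R) (sin \o f) (cos (f x) * (f^`())%classic x).
  by move=> cf; apply: is_derive1_comp; exact: Ck_derive cf _.
elim: k f dc ds => [|k IH] f dc ds cf.
  by split; split=> // x; [case: (dc x cf)|case: (ds x cf)].
have [cc cs] := IH f (fun x _ => dc x cf) (fun x _ => ds x cf) (CkW cf).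
split; [apply: Ck_is_derive (fun x => dc x cf) _|apply: Ck_is_derive (fun x => ds x cf) _].
  rewrite (_ : (fun _ => _) = cst (-1) \* ((sin \o f) \* (f^`())%classic)).
    by apply: CkM; [exact: Ck_cst|apply: CkM => //; case: cf].
  by apply/funext => x /=; rewrite mulN1r mulNr.
by apply: CkM => //; case: cf.
Qed.

Lemma smooth_derivable f : smooth f -> forall x, derivable f x 1.
Proof. by move=> sf; exact: (sf 0%N). Qed.

Lemma smooth_is_derive f x : smooth f -> is_derive x (1 : R) f ((f^`())%classic x).
Proof. by move=> /smoothP sf; exact: Ck_derive (sf 0%N) _. Qed.

Lemma smooth_continuous f : smooth f -> continuous f.
Proof.
move=> sf x; apply/differentiable_continuous/derivable1_diffP.
exact: smooth_derivable.
Qed.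

Lemma smooth_cst c : smooth (cst c).
Proof. by apply/smoothP => k; exact: Ck_cst. Qed.

Lemma smooth_derive1 f : smooth f -> smooth (f^`())%classic.
Proof. by move=> /smoothP sf; apply/smoothP => k; case: (sf k.+1). Qed.

Lemma smoothD f g : smooth f -> smooth g -> smooth (f \+ g).
Proof. by move=> /smoothP sf /smoothP sg; apply/smoothP => k; exact: CkD. Qed.

Lemma smoothM f g : smooth f -> smooth g -> smooth (f \* g).
Proof. by move=> /smoothP sf /smoothP sg; apply/smoothP => k; exact: CkM. Qed.

Lemma smooth_horner p : smooth (horner p).
Proof. by apply/smoothP => k; exact: Ck_horner. Qed.

Lemma smooth_affine f c b : smooth f -> smooth (fun y => f (c * y + b)).
Proof. by move=> /smoothP sf; apply/smoothP => k; exact: Ck_affine. Qed.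

Lemma smooth_cos f : smooth f -> smooth (cos \o f).
Proof. by move=> /smoothP sf; apply/smoothP => k; have [] := Ck_cos_sin (sf k). Qed.

Lemma smooth_sin f : smooth f -> smooth (sin \o f).
Proof. by move=> /smoothP sf; apply/smoothP => k; have [] := Ck_cos_sin (sf k). Qed.

(* The derivatives of exp (- 1 / x), extended by 0, are linear combinations of
   this family. *)
Definition flat n x : R := if 0 < x then x^-1 ^+ n * expR (- x^-1) else 0.

(** The exponential series gives [exp (1/x) >= (1/x)^(n+2) / (n+2)!]. Two powers more than [n] leave
    a factor [x^2], which forces a zero derivative at 0. *)
Lemma flat_le n x : 0 < x -> flat n x <= n.+2`!%:R * x ^+ 2.
Proof.
move=> x0; rewrite /flat x0 expRN ler_pdivrMr ?expR_gt0//.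
have xi0 : 0 <= x^-1 by rewrite invr_ge0 ltW.
have fact0 : 0 < n.+2`!%:R :> R by rewrite ltr0n fact_gt0.
have h : x^-1 ^+ n.+2 / n.+2`!%:R <= expR x^-1.
  by apply: le_trans (expR_ge1Dxn n.+1 xi0); rewrite lerDr.
have := ler_wpM2l (ltW (mulr_gt0 fact0 (exprn_gt0 2 x0))) h; apply: le_trans.
rewrite (_ : _ * (_ / _) = x^-1 ^+ n)// -addn2 exprD; field.
by rewrite !gt_eqF.
Qed.

Lemma flat_ge0 n x : 0 <= flat n x.
Proof.
rewrite /flat; case: ifPn => // x0.
by rewrite mulr_ge0 ?expR_ge0// exprn_ge0// invr_ge0 ltW.
Qed.

Lemma is_derive_flat n x :
  is_derive x (1 : R) (flat n) (flat n.+2 x - n%:R * flat n.+1 x).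
Proof.
have [x0|x0|->] := ltgtP x 0.
- rewrite {2 3}/flat ltNge (ltW x0)/= mulr0 subr0.
  apply: (near_eq_is_derive _ (is_derive_cst (0 : R) x (1 : R))).
  near=> y; rewrite /flat ltNge ltW//; near: y; exact: lt_nbhsl.
- rewrite {2 3}/flat x0.
  have xn0 : x != 0 by rewrite gt_eqF.
  have dV : is_derive x (1 : R) (fun y : R => y^-1) (- x ^- 2).
    have := is_deriveV xn0 (is_derive_id x (1 : R)).
    by rewrite [_ *: _]mulr1.
  have dX := is_deriveX n dV.
  have dN := is_deriveN dV.
  have dE := @is_derive1_comp _ expR (fun y => - y^-1) x _ _ (is_derive_expR _) dN.
  have := is_deriveM dX dE; rewrite exprfctE => dM.
  rewrite (_ : _ - _ = (x^-1 ^+ n) *: (expR (- x^-1) * - - x ^- 2) +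
      expR (- x^-1) *: ((n%:R * x^-1 ^+ n.-1) *: - x ^- 2)).
    apply: (near_eq_is_derive _ dM).
    near=> y; rewrite /flat ifT//; near: y; exact: lt_nbhsr.
  rewrite /GRing.scale/= opprK -exprVn.
  by case: n {dX dM} => [|n]; rewrite ?exprS ?expr0/=; ring.
(* At 0 the function vanishes on the left and is quadratically small on the right. *)
- apply: is_derive_small => e e0; rewrite /flat ltxx mulr0 subr0.
  have fact0 : 0 < n.+2`!%:R :> R by rewrite ltr0n fact_gt0.
  exists (e / n.+2`!%:R); first by rewrite divr_gt0.
  move=> t te; rewrite mulr0 add0r !subr0 -/(flat n t).
  have [t0|t0] := ltP 0 t; last by rewrite /flat ltNge t0 normr0 mulr_ge0 ?(ltW e0).
  rewrite (ger0_norm (flat_ge0 _ _)); apply: le_trans (flat_le _ t0) _.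
  rewrite gtr0_norm// in te *; rewrite expr2 mulrA ler_wpM2r ?(ltW t0)// mulrC.
  by rewrite -ler_pdivlMr.
Unshelve. all: by end_near. Qed.

Lemma smooth_flat n : smooth (flat n).
Proof.
apply/smoothP => k; elim: k n => [|k IH] n.
  by split=> // x; case: (is_derive_flat n x).
apply: Ck_is_derive (is_derive_flat n) _.
rewrite (_ : (fun _ => _) = flat n.+2 \+ cst (- n%:R) \* flat n.+1).
  by apply: CkD => //; apply: CkM => //; exact: Ck_cst.
by apply/funext => x /=; rewrite mulNr.
Qed.

(* Since flat 0 (n y) increases to 1 for y > 0, these functions converge to the
   indicator of ]a, b[ without any normalising quotient. *)
Definition bump a b n x := flat 0 (n%:R * x + - (n%:R * a)) * flat 0 (- n%:R * x + n%:R * b).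

Lemma smooth_bump a b n : smooth (bump a b n).
Proof. by apply: smoothM; apply: smooth_affine; exact: smooth_flat. Qed.

Lemma flat0_le1 x : flat 0 x <= 1.
Proof.
rewrite /flat; case: ifPn => // x0; rewrite expr0 mul1r -expR0 ler_expR.
by rewrite oppr_le0 invr_ge0 ltW.
Qed.

Lemma bump_ge0 a b n x : 0 <= bump a b n x.
Proof. by rewrite mulr_ge0 ?flat_ge0. Qed.

Lemma bump_le1 a b n x : bump a b n x <= 1.
Proof. by rewrite mulr_ile1 ?flat_ge0 ?flat0_le1. Qed.

Lemma bump_out a b n x : ~~ (a < x < b) -> bump a b n x = 0.
Proof.
rewrite negb_and -!leNgt /bump /flat => /orP[xa|bx].
  rewrite [X in X * _](_ : _ = 0) ?mul0r// ltNge -mulrBr mulr_ge0_le0//.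
  by rewrite subr_le0.
rewrite [X in _ * X](_ : _ = 0) ?mulr0// ltNge mulNr addrC -mulrBr mulr_ge0_le0//.
by rewrite subr_le0.
Qed.

Lemma flat0_cvg y : 0 < y -> flat 0 (n%:R * y) @[n --> \oo] --> (1 : R).
Proof.
move=> y0.
have h : expR (- (n%:R * y)^-1) @[n --> \oo] --> (1 : R).
  rewrite -[in X in _ --> X]expR0; apply: continuous_cvg; first exact: continuous_expR.
  rewrite -[0 in X in _ --> X]oppr0; apply: cvgN.
  apply/(@gtr0_cvgV0 _ _ _ _ (fun n : nat => n%:R * y)).
    near=> n; rewrite mulr_gt0// ltr0n; near: n; exact: nbhs_infty_gt.
  apply/cvgryPge => A; have /cvgryPge/(_ (A / y)) := @cvgr_idn R.
  by apply: filterS => n; rewrite ler_pdivrMr.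
apply: cvg_trans h; apply: near_eq_cvg; near=> n.
rewrite /flat ifT ?expr0 ?mul1r// mulr_gt0// ltr0n; near: n.
exact: nbhs_infty_gt.
Unshelve. all: by end_near. Qed.

Lemma bump_cvg a b x : bump a b n x @[n --> \oo] --> (\1_(`]a, b[%classic) x : R).
Proof.
rewrite indicE; have [|xab] := boolP (x \in _).
  rewrite inE/= in_itv/= => /andP[ax xb].
  rewrite -[1%:R in X in _ --> X]mulr1.
  have := cvgM (@flat0_cvg (x - a) _) (@flat0_cvg (b - x) _).
  rewrite !subr_gt0 => /(_ _ ax xb); apply: cvg_trans.
  apply: near_eq_cvg; apply: nearW => n /=.
  by rewrite /bump mulNr [X in _ = _ * flat 0 X]addrC -!mulrBr.
rewrite notin_setE/= in_itv/= in xab.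
rewrite (_ : bump _ _ ^~ _ = cst 0); first exact: cvg_cst.
by apply/funext => n; apply: bump_out; apply/negP.
Qed.

End Smooth.

Arguments smooth_cst {R} c _ _.
Arguments smooth_derive1 {R f} _ _ _.
Arguments smoothD {R f g} _ _ _ _.
Arguments smoothM {R f g} _ _ _ _.
Arguments smooth_horner {R} p _ _.
Arguments smooth_affine {R f} c b _ _ _.
Arguments smooth_cos {R f} _ _ _.
Arguments smooth_sin {R f} _ _ _.
Arguments smooth_bump {R} a b n _ _.

(** * Weighted translations *)

Section WeightedTranslation.
Context {R : realType}.
Local Notation mu := (@lebesgue_measure R).
Local Notation L2 := (L2 R).
Local Open Scope quotient_scope.
Implicit Types (phi psi : L2) (p q : {poly R}) (a b t : R).

Definition phase t : R[i] := cos t +i* sin t.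

Lemma phaseD s t : phase (s + t) = phase s * phase t.
Proof. by rewrite /phase cosD sinD; simpc; congr (_ +i* _); ring. Qed.

Lemma phase0 : phase 0 = 1.
Proof. by rewrite /phase cos0 sin0. Qed.

Lemma modulus_phase t : modulus (phase t) = 1.
Proof. by rewrite /modulus normc_def/= cos2Dsin2 sqrtr1. Qed.

Lemma conj_phase t : conjc (phase t) * phase t = 1.
Proof.
apply/eqP; rewrite eq_complex /= -(cos2Dsin2 t).
by apply/andP; split; apply/eqP; ring.
Qed.

Definition wt p a (f : R -> R[i]) : R -> R[i] := fun x => phase p.[x] * f (x + a).

Lemma modulus_wt p a f x : modulus (wt p a f x) = modulus (f (x + a)).
Proof. by rewrite /wt modulusM modulus_phase mul1r. Qed.

Lemma cmeasurable_shift a (f : R -> R[i]) : cmeasurable f ->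
  cmeasurable (fun x => f (x + a)).
Proof.
move=> [mr mi]; have ms := @measurable_shift R a.
by split; [exact: (measurableT_comp mr ms)|exact: (measurableT_comp mi ms)].
Qed.

Lemma cmeasurable_phase p : cmeasurable (fun x => phase p.[x]).
Proof.
split; apply: continuous_measurable_fun => x.
  exact: (continuous_comp (@continuous_horner R p x) (@continuous_cos R _)).
exact: (continuous_comp (@continuous_horner R p x) (@continuous_sin R _)).
Qed.

Lemma cmeasurable_wt p a (f : R -> R[i]) : cmeasurable f -> cmeasurable (wt p a f).
Proof.
move=> mf; apply: (cmeasurableM (cmeasurable_phase p)).
exact: cmeasurable_shift.
Qed.

Lemma measurable_modulus_sqr (f : R -> R[i]) : cmeasurable f ->
  measurable_fun [set: R] (fun x => ((modulus (f x)) ^+ 2)%:E).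
Proof.
by move=> mf; apply/measurable_EFinP/measurable_funX; exact: measurable_modulus.
Qed.

Lemma eL2norm_wt p a (f : R -> R[i]) : cmeasurable f ->
  eL2norm (wt p a f) = eL2norm f.
Proof.
move=> mf; have E g : eL2norm g = ((eL2norm g `^ 2) `^ 2^-1)%E.
  by rewrite -poweRrM mulfV// poweRe1// Lnorm_ge0.
rewrite E [RHS]E !eL2norm_sqr; congr (_ `^ _)%E.
rewrite -(integral_shift a (measurable_modulus_sqr mf)).
by apply: eq_integral => x _; rewrite modulus_wt.
Qed.

Lemma wt_sqint p a (f : sqfun R) : wt p a f \in sqint R.
Proof.
have [mf lf] := sqfunP f; apply/asboolP; split; first exact: cmeasurable_wt.
by move: lf; rewrite -(eL2norm_wt p a mf).
Qed.

Definition wtL p a phi : L2 := \pi_L2 (SqFun (wt_sqint p a (repr phi))).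

Lemma wtLE p a phi : \forall x \ae mu, wtL p a phi x = wt p a phi x.
Proof. exact: L2fun_pi. Qed.

(** Translations preserve null sets, so any representative, in particular a test function, may
    replace the chosen one. *)
Lemma wtL_pi p a (f : R -> R[i]) phi : (\forall x \ae mu, phi x = f x) ->
  \forall x \ae mu, wtL p a phi x = wt p a f x.
Proof.
have F := ae_filter_ringOfSetsType mu.
move=> /(ae_shift a) phif; apply: filterS2 (wtLE p a phi) phif => x ->.
by rewrite /wt => ->.
Qed.

Lemma wtL_linear p a : linear (wtL p a).
Proof.
have F := ae_filter_ringOfSetsType mu.
move=> c phi psi; apply: L2_ext.
apply: filter_app (L2funD (c *: wtL p a phi) (wtL p a psi)).
apply: filter_app (L2funZ c (wtL p a phi)).
apply: filter_app (wtLE p a phi); apply: filter_app (wtLE p a psi).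
apply: filter_app (ae_shift a (L2funZ c phi)).
apply: filter_app (ae_shift a (L2funD (c *: phi) psi)).
apply: filterS (wtLE p a (c *: phi + psi)) => x + h1 h2 h3 h4 h5 h6.
by rewrite h6 h5 h4 h3 => ->; rewrite /wt h1 h2 mulrDr mulrCA.
Qed.

(** Moving the translation by [a] past the phase of [q] turns [q] into [q(X + a)]. *)
Lemma wtL_comp p a q b phi :
  wtL p a (wtL q b phi) = wtL (p + (q \Po ('X + a%:P))) (a + b) phi.
Proof.
have F := ae_filter_ringOfSetsType mu.
apply: L2_ext; apply: filterS2 (wtL_pi p a (wtLE q b phi))
  (wtLE (p + (q \Po ('X + a%:P))) (a + b) phi).
move=> x -> ->; by rewrite /wt !(hornerD, horner_comp, hornerX, hornerC) phaseD -mulrA addrA.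
Qed.

Lemma eq_wtL p q a : (forall x, p.[x] = q.[x]) -> wtL p a = wtL q a.
Proof.
have F := ae_filter_ringOfSetsType mu.
move=> pq; apply/funext => phi; apply: L2_ext.
by apply: filterS2 (wtLE p a phi) (wtLE q a phi) => x -> ->; rewrite /wt pq.
Qed.

Lemma wtL0 phi : wtL 0 0 phi = phi.
Proof.
have F := ae_filter_ringOfSetsType mu.
apply: L2_ext; apply: filterS (wtLE 0 0 phi) => x ->.
by rewrite /wt horner0 phase0 mul1r addr0.
Qed.

Lemma wtL_dot p a phi psi : dot (wtL p a phi) (wtL p a psi) = dot phi psi.
Proof.
have F := ae_filter_ringOfSetsType mu.
have mdot (f g : R -> R[i]) : cmeasurable f -> cmeasurable g ->
    cmeasurable (fun x => conjc (f x) * g x).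
  by move=> mf mg; exact: (cmeasurableM (cmeasurable_conj mf) mg).
have m := mdot _ _ (cmeasurable_L2 phi) (cmeasurable_L2 psi).
rewrite /dot -(cintegral_shift a m); apply: eq_cintegral_ae.
- by apply: mdot; exact: cmeasurable_L2.
- exact: cmeasurable_shift m.
- apply: filterS2 (wtLE p a phi) (wtLE p a psi) => x -> ->.
  rewrite /wt rmorphM/= mulrACA.
  by rewrite conj_phase mul1r.
Qed.

Lemma wtL_nrm p a phi : nrm (wtL p a phi) = nrm phi.
Proof.
apply/eqP; rewrite -(eqrXn2 (_ : 0 < 2)%N) ?nrm_ge0//.
by apply/eqP/complexI; rewrite -!dot_self wtL_dot.
Qed.

End WeightedTranslation.

(** * The operators T_w on polynomials *)

Section Average.
Context {R : realType}.
Implicit Types (P Q S : {poly R}) (u v w x s t : R).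

(* T_w P, expanded by Taylor's formula. *)
Definition avg w P : {poly R} :=
  \sum_(j < size P) (w ^+ j / j.+1%:R) *: P^`N(j).

(** The added derivatives vanish; a common range of summation makes polynomials of different sizes
    comparable. *)
Lemma avg_wide N w P : (size P <= N)%N ->
  avg w P = \sum_(j < N) (w ^+ j / j.+1%:R) *: P^`N(j).
Proof.
move=> PN; rewrite /avg (big_ord_widen N (fun j => (w ^+ j / j.+1%:R) *: P^`N(j)) PN).
rewrite big_mkcond/=; apply: eq_bigr => j _; case: ifPn => //.
rewrite -leqNgt => sj; rewrite nderivn_poly0 ?scaler0//.
Qed.

Lemma size_nderivn_le P j : (size P^`N(j) <= size P - j)%N.
Proof.
apply/leq_sizeP => i; rewrite leq_subLR => ij.
by rewrite coef_nderivn nth_default// ?mul0rn// addnC.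
Qed.

Lemma size_avg w P : (size (avg w P) <= size P)%N.
Proof.
apply: leq_trans (size_sum _ _ _) _; apply/bigmax_leqP => j _.
apply: leq_trans (size_scale_leq _ _) _.
exact: leq_trans (size_nderivn_le _ _) (leq_subr _ _).
Qed.

Lemma avgD w P Q : avg w (P + Q) = avg w P + avg w Q.
Proof.
set N := maxn (size (P + Q)) (maxn (size P) (size Q)).
rewrite !(@avg_wide N) ?leq_max ?leqnn ?orbT// -big_split; apply: eq_bigr => j _.
by rewrite nderivnD scalerDr.
Qed.

(** Induction on the size: the term [j = 0] of [avg w S] is [S], so [S - avg w S] is smaller. If [P]
    is a preimage of it, then [S + P] is a preimage of [S]. *)
Lemma avg_surj w k S : (size S <= k)%N ->
  exists2 P : {poly R}, (size P <= k)%N & avg w P = S.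
Proof.
elim: k S => [|k IH] S Sk.
  exists 0; first by rewrite size_poly0.
  by rewrite /avg size_poly0 big_ord0; apply/esym/eqP; rewrite -size_poly_leq0.
have dS : (size (S - avg w S)%R <= k)%N.
  rewrite (@avg_wide k.+1)// big_ord_recl expr0 divr1 scale1r nderivn0 opprD addrA.
  rewrite subrr add0r size_polyN; apply: leq_trans (size_sum _ _ _) _.
  apply/bigmax_leqP => j _; apply: leq_trans (size_scale_leq _ _) _.
  apply: leq_trans (size_nderivn_le _ _) _.
  by rewrite leq_subLR (leq_trans Sk)// lift0 addSn ltnS leq_addl.
have [P Pk PS] := IH _ dS.
exists (S + P); last by rewrite avgD PS addrC subrK.
by apply: leq_trans (size_polyD _ _) _; rewrite geq_max Sk (leq_trans Pk).
Qed.

(* The value at x is the integral of P(x + su) for s from 0 to t, i.e. the phase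
   of e^{it(up + P(q))}. *)
Definition theta u P t : {poly R} := t *: avg (t * u) P.

Lemma theta0 u P : theta u P 0 = 0.
Proof. by rewrite /theta scale0r. Qed.

Lemma theta1 u P : theta u P 1 = avg u P.
Proof. by rewrite /theta scale1r mul1r. Qed.

Lemma is_derive_theta u P x t :
  is_derive t (1 : R) (fun r => (theta u P r).[x]) P.[x + t * u].
Proof.
(* For fixed [x] the phase is this polynomial in the time variable, and its derivative is the Taylor
   expansion of [P] at [x] with increment [t * u]. *)
pose Q := \sum_(j < size P) (u ^+ j / j.+1%:R * P^`N(j).[x]) *: 'X^(j.+1).
have := is_derive_poly Q t.
rewrite (_ : horner Q = fun r => (theta u P r).[x]); last first.
  apply/funext => r; rewrite /theta hornerZ !horner_sum mulr_sumr; apply: eq_bigr => j _.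
  by rewrite !hornerZ hornerXn exprMn exprS; ring.
rewrite (_ : Q^`().[t] = P.[x + t * u])//.
rewrite nderiv_taylor; last exact: mulrC.
rewrite raddf_sum horner_sum; apply: eq_bigr => j _.
have j0 : j.+1%:R != 0 :> R by rewrite pnatr_eq0.
rewrite /= derivZ derivXn hornerZ hornerMn hornerXn/= -[_ ^+ j *+ _]mulr_natr exprMn.
by move: (j.+1%:R) j0 => k k0; field.
Qed.

(** This cocycle identity is what makes [weyl_group] a group. Both sides have the same derivative in
    [t] and agree at [t = 0]. *)
Lemma thetaD u P s t x :
  (theta u P (s + t)).[x] = (theta u P s).[x] + (theta u P t).[x + s * u].
Proof.
pose f r := (theta u P (s + r)).[x] - (theta u P r).[x + s * u].
have df r : is_derive r (1 : R) f 0.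
  have h1 := @is_derive_theta u P (x + s * u) r.
  have h2 := @is_derive_affine _ (fun r => (theta u P r).[x]) 1 s r _ (is_derive_theta u P x _).
  have := is_deriveB h2 h1; rewrite !mul1r.
  rewrite (_ : x + (r + s) * u = x + s * u + r * u) ?subrr; last by ring.
  rewrite (_ : _ - _ = f)//; apply/funext => y; rewrite /f !fctE mul1r addrC.
  by rewrite addrC [s + y]addrC.
have := is_derive_0_is_cst t 0 df; rewrite /f theta0 horner0 subr0 addr0 => /eqP.
by rewrite subr_eq => /eqP.
Qed.

(** Averaging commutes with translation: [avg] is [theta] at time 1, and the two phases agree at
    time 0 and have the same time derivative. *)
Lemma avg_shift u v Q x : (avg v (Q \Po ('X + u%:P))).[x] = (avg v Q).[x + u].
Proof.
pose f r := (theta v (Q \Po ('X + u%:P)) r).[x] - (theta v Q r).[x + u].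
have df r : is_derive r (1 : R) f 0.
  have := is_deriveB (is_derive_theta v (Q \Po ('X + u%:P)) x r)
    (is_derive_theta v Q (x + u) r).
  rewrite (_ : (_ \Po _).[_] - _ = 0)// horner_comp !hornerE.
  by rewrite (_ : x + r * v + u = x + u + r * v) ?subrr//; ring.
have := is_derive_0_is_cst 1 0 df; rewrite /f !theta0 !theta1 !horner0 subr0 => /eqP.
by rewrite subr_eq0 => /eqP.
Qed.

Lemma oriented_integral_deriv Q w :
  oriented_integral 0 w (horner Q^`()) = Q.[w] - Q.[0].
Proof.
have FTC (a b : R) : a < b -> \int[lebesgue_measure]_(y in `[a, b]) Q^`().[y] = Q.[b] - Q.[a].
  move=> ab; rewrite /Rintegral (@continuous_FTC2 _ _ (horner Q))//.
  - by apply: continuous_subspaceT; exact: continuous_horner.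
  - split.
    + by move=> y _; exact: derivable_horner.
    + by apply: cvg_at_right_filter; exact: continuous_horner.
    + by apply: cvg_at_left_filter; exact: continuous_horner.
  - by move=> y _; rewrite derivE.
rewrite /oriented_integral; case: ltgtP => [w0|w0|<-].
- exact: FTC.
- by rewrite FTC// opprB.
- by rewrite set_itv1 Rintegral_set1 subrr.
Qed.

Lemma comp_poly_taylor P y :
  P \Po ('X + y%:P) = \sum_(j < size P) y ^+ j *: P^`N(j).
Proof.
rewrite /comp_poly nderiv_taylor; last exact: mulrC.
rewrite size_map_polyC; apply: eq_bigr => j _.
rewrite nderivn_map -[_.['X]]/(_ \Po 'X) comp_polyXr -mul_polyC mulrC.
by rewrite rmorphXn.
Qed.

Lemma average_coef n w (P : {poly_n.+1 R}) : average w P = avg w P :> {poly R}.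
Proof.
have Pn : (size (P : {poly R}) <= n.+1)%N by exact: size_npoly.
rewrite /average; case: eqP => [->|/eqP w0].
  rewrite (avg_wide _ Pn) big_ord_recl expr0 divr1 scale1r nderivn0 big1 ?addr0// => j _.
  by rewrite lift0 expr0n mul0r scale0r.
apply/polyP => i; rewrite coefZ.
have [ni|ni] := leqP n.+1 i.
  rewrite [RHS]nth_default ?nth_default ?mulr0//.
    by rewrite (leq_trans _ ni)// size_npoly.
  by rewrite (leq_trans _ ni)// (leq_trans (size_avg _ _)).
(* The antiderivative, vanishing at 0, of the coefficient of index [i] of [P(X + y)] as a function
   of [y]. *)
pose Q : {poly R} := \sum_(j < n.+1) (P^`N(j)`_i / j.+1%:R) *: 'X^(j.+1).
have QE y : Q.[y] = y * \sum_(j < n.+1) y ^+ j / j.+1%:R * P^`N(j)`_i.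
  rewrite horner_sum mulr_sumr; apply: eq_bigr => j _.
  by rewrite hornerZ hornerXn exprS; ring.
have dQ : (fun y => (translate y P : {poly R})`_i) = horner Q^`().
  apply/funext => y; rewrite /= comp_poly_taylor coef_sum raddf_sum horner_sum.
  rewrite (big_ord_widen n.+1 (fun j => (y ^+ j *: P^`N(j))`_i) Pn) big_mkcond/=.
  apply: eq_bigr => j _; rewrite /= derivZ derivXn hornerZ hornerMn hornerXn coefZ/=.
  case: ifPn => [_|]; first by rewrite -[_ ^+ j *+ _]mulr_natr mulrA mulrAC divfK ?pnatr_eq0//
    mulrC.
  by rewrite -leqNgt => sj; rewrite nderivn_poly0// coef0 !mul0r.
rewrite coef_poly ni dQ oriented_integral_deriv !QE mul0r subr0 mulKf//.
by rewrite (avg_wide _ Pn) coef_sum; apply: eq_bigr => j _; rewrite coefZ.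
Qed.

(** A partial inverse is a right inverse on the image, so this is the surjectivity of [avg w] on
    polynomials of size at most [n.+1]. *)
Lemma average_invK n w (S : {poly_n.+1 R}) : average w (average_inv w S) = S.
Proof.
have Sn : (size (S : {poly R}) <= n.+1)%N by exact: size_npoly.
have [P0 P0n P0S] := avg_surj w Sn.
pose P : {poly_n.+1 R} := NPoly (P0n : P0 \is a poly_of_size n.+1).
have PS : average w P = S by apply: val_inj; rewrite /= average_coef.
by apply: pinvK; rewrite inE; exists P.
Qed.

End Average.

(** * Test functions *)

Section TestFunctions.
Context {R : realType}.
Local Notation mu := (@lebesgue_measure R).
Local Notation L2 := (L2 R).
Local Notation Re := (@complex.Re R).
Local Notation Im := (@complex.Im R).
Implicit Types (f g : R -> R[i]) (h : R -> R) (M K : R) (p P : {poly R}).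

Lemma compact_suppP f : compact (closure [set x | f x != 0]) <->
  exists M : R, forall x, M < `|x| -> f x = 0.
Proof.
split=> [/compact_bounded[M [_ HM]]|[M HM]].
  exists (M + 1) => x Mx; apply/eqP/negP => /negP fx.
  have M1 : M < M + 1 by rewrite ltrDl.
  by have := HM _ M1 x (@subset_closure _ [set x | f x != 0] x fx); rewrite /= leNgt Mx.
apply: (@subclosed_compact _ _ `[- M, M]%classic); first exact: closed_closure.
  exact: segment_compact.
rewrite (closure_id `[- M, M]%classic).1; last exact: interval_closed.
apply: closureS => x /= fx; rewrite in_itv/= -ler_norml leNgt; apply/negP => /HM.
by move/eqP; apply/negP.
Qed.

Lemma test_functionP f : test_function f <->
  [/\ smooth (Re \o f), smooth (Im \o f) &
      exists M : R, forall x, M < `|x| -> f x = 0].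
Proof. by split=> -[? ? /compact_suppP]. Qed.

Lemma test_lin (c : R) f g : test_function f -> test_function g ->
  test_function (fun x => c%:C * f x + g x).
Proof.
move=> /test_functionP[rf jf [M HM]] /test_functionP[rg jg [N HN]].
apply/test_functionP; split.
- rewrite (_ : _ \o _ = (cst c \* (Re \o f)) \+ (Re \o g)).
    exact: smoothD (smoothM (smooth_cst c) rf) rg.
  by apply/funext => x /=; case: (f x) (g x) => [? ?] [? ?] /=; rewrite mul0r subr0.
- rewrite (_ : _ \o _ = (cst c \* (Im \o f)) \+ (Im \o g)).
    exact: smoothD (smoothM (smooth_cst c) jf) jg.
  by apply/funext => x /=; case: (f x) (g x) => [? ?] [? ?] /=; rewrite mul0r addr0.
- exists (Num.max M N) => x; rewrite gt_max => /andP[/HM -> /HN ->].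
  by rewrite mulr0 addr0.
Qed.

Lemma wt_supp p (a : R) f M : (forall x, M < `|x| -> f x = 0) ->
  forall x, M + `|a| < `|x| -> wt p a f x = 0.
Proof.
move=> fM x Mx; rewrite /wt fM ?mulr0//.
by rewrite -(ltrD2r `|a|) (lt_le_trans Mx)// -{1}(addrK a x) ler_normB.
Qed.

Lemma test_wt p (a : R) f : test_function f -> test_function (wt p a f).
Proof.
move=> /test_functionP[rf jf [M HM]].
have sa h : smooth h -> smooth (fun x => h (x + a)).
  move=> /(smooth_affine 1 a); congr smooth; apply/funext => x.
  by rewrite mul1r.
have sc := smooth_cos (smooth_horner p); have ss := smooth_sin (smooth_horner p).
apply/test_functionP; split.
- rewrite (_ : _ \o _ = ((cos \o horner p) \* (fun x => Re (f (x + a)))) \+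
     (cst (-1) \* ((sin \o horner p) \* (fun x => Im (f (x + a)))))).
    apply: smoothD; first exact: smoothM sc (sa _ rf).
    exact: smoothM (smooth_cst (-1)) (smoothM ss (sa _ jf)).
  by apply/funext => x /=; rewrite /wt /phase; case: (f _) => ? ? /=; ring.
- rewrite (_ : _ \o _ = ((cos \o horner p) \* (fun x => Im (f (x + a)))) \+
     ((sin \o horner p) \* (fun x => Re (f (x + a))))).
    exact: smoothD (smoothM sc (sa _ jf)) (smoothM ss (sa _ rf)).
  by apply/funext => x /=; rewrite /wt /phase; case: (f _) => ? ? /=; ring.
- by exists (M + `|a|) => x Mx; rewrite (wt_supp _ HM).
Qed.

Lemma continuous_supp_bounded h M : continuous h -> (forall x, M < `|x| -> h x = 0) ->
  exists2 K : R, 0 <= K & forall x, `|h x| <= K.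
Proof.
(* A negative [M] forces [h = 0]; otherwise the segment is nonempty and the maximum exists. *)
move=> ch HM; have [M0|M0] := ltP M 0.
  by exists 0 => // x; rewrite HM ?normr0// (lt_le_trans M0).
have MM : - M <= M by rewrite (le_trans _ M0)// oppr_le0.
have cN : {within `[- M, M], continuous (fun x => `|h x|)}.
  by apply: continuous_subspaceT => x; apply: cvg_norm; exact: ch.
have [c _ Hc] := EVT_max MM cN; exists `|h c| => // x.
have [/HM ->|xM] := ltP M `|x|; first by rewrite normr0.
by apply: Hc; rewrite in_itv/= -ler_norml.
Qed.

Lemma test_bounded f : test_function f ->
  exists2 K : R, 0 <= K & forall x, `|Re (f x)| <= K /\ `|Im (f x)| <= K.
Proof.
move=> /test_functionP[rf jf [M HM]].
have [|K K0 HK] := @continuous_supp_bounded _ M (smooth_continuous rf).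
  by move=> x /HM /= ->.
have [|L L0 HL] := @continuous_supp_bounded _ M (smooth_continuous jf).
  by move=> x /HM /= ->.
exists (Num.max K L); first by rewrite le_max K0.
by move=> x; split; rewrite le_max ?HK ?HL ?orbT.
Qed.

Lemma cmeasurable_test f : test_function f -> cmeasurable f.
Proof.
move=> [rf jf _]; split; apply: continuous_measurable_fun => x.
  exact: smooth_continuous rf _.
exact: smooth_continuous jf _.
Qed.

(** The squared modulus is at most [2 K^2] on a segment of length [2 M] and vanishes outside it. *)
Lemma integral_modulus_le f M K : cmeasurable f -> 0 <= M -> 0 <= K ->
  (forall x, M < `|x| -> f x = 0) ->
  (forall x, `|Re (f x)| <= K /\ `|Im (f x)| <= K) ->
  (\int[mu]_x ((modulus (f x)) ^+ 2)%:E <= (4 * M * K ^+ 2)%:E)%E.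
Proof.
move=> mf M0 K0 HM HK.
apply: (@le_trans _ _ (\int[mu]_x ((2 * K ^+ 2)%:E * (\1_(`[- M, M]%classic) x)%:E))%E).
  apply: ge0_le_integral => //.
  - by move=> x _; rewrite lee_fin sqr_ge0.
  - exact: measurable_modulus_sqr.
  - by apply: measurable_funeM; apply/measurable_EFinP; exact: measurable_indic.
  - move=> x _; rewrite -EFinM lee_fin indicE.
    have [xM|xM] := leP `|x| M; last first.
      by rewrite (HM _ xM) modulus_sqr/= expr0n addr0 mulr_ge0// mulr_ge0// sqr_ge0.
    rewrite mem_set/= ?in_itv/= -?ler_norml// mulr1 modulus_sqr.
    have [h1 h2] := HK x.
    have sq (a : R) : `|a| <= K -> a ^+ 2 <= K ^+ 2.
      by move=> aK; rewrite -real_normK ?num_real// lerXn2r.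
    by rewrite mulr2n mulrDl mul1r lerD// sq.
rewrite ge0_integralZl//; last first.
- by rewrite lee_fin mulr_ge0// sqr_ge0.
- by apply/measurable_EFinP; exact: measurable_indic.
rewrite integral_indic//= setIT lebesgue_measure_itv/= lte_fin.
case: ifPn => _; last by rewrite mule0 lee_fin !mulr_ge0// sqr_ge0.
rewrite -EFinB -EFinM lee_fin; lra.
Qed.

Lemma sqint_test f : test_function f -> f \in sqint R.
Proof.
move=> tf; have mf := cmeasurable_test tf; apply/asboolP; split=> //.
have [K K0 HK] := test_bounded tf.
have /test_functionP[_ _ [M HM]] := tf.
have HM' x : Num.max M 0 < `|x| -> f x = 0 by rewrite gt_max => /andP[/HM].
have M0 : 0 <= Num.max M 0 by rewrite le_max lexx orbT.
have := integral_modulus_le mf M0 K0 HM' HK.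
rewrite -eL2norm_sqr => /le_lt_trans/(_ (ltry _)) => h.
rewrite /finite_norm; apply: contraTlt h; rewrite !leye_eq => /eqP.
rewrite -[X in X = _]/(eL2norm f) => ->.
by rewrite poweRyr.
Qed.

(** Converts uniform pointwise bounds on a fixed bounded set into bounds of the L2 norm. *)
Lemma nrm_le_supp (chi : L2) f M K : cmeasurable f -> 0 <= M -> 0 <= K ->
  (\forall x \ae mu, chi x = f x) ->
  (forall x, M < `|x| -> f x = 0) ->
  (forall x, `|Re (f x)| <= K /\ `|Im (f x)| <= K) ->
  nrm chi <= Num.sqrt (4 * M) * K.
Proof.
have F := ae_filter_ringOfSetsType mu.
move=> mf M0 K0 chif HM HK.
rewrite -(@ler_pXn2r _ 2%N) ?nnegrE ?nrm_ge0 ?mulr_ge0// exprMn sqr_sqrtr ?mulr_ge0//.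
rewrite -lee_fin nrm_sqr; apply: le_trans (integral_modulus_le mf M0 K0 HM HK).
rewrite le_eqVlt; apply/orP; left; apply/eqP.
apply: ge0_ae_eq_integral => //.
- by apply: measurable_modulus_sqr; exact: cmeasurable_L2.
- exact: measurable_modulus_sqr.
- by move=> x _; rewrite lee_fin sqr_ge0.
- by move=> x _; rewrite lee_fin sqr_ge0.
- by apply: filterS chif => x -> _.
Qed.

Definition weyl_op (u : R) P f : R -> R[i] :=
  u%:C *: momentum f + poly_position P f.

Lemma poly_positionE P f x : poly_position P f x = P.[x]%:C * f x.
Proof.
have itE i : iter i position f x = (x ^+ i)%:C * f x.
  elim: i => [|i IH] /=; first by rewrite expr0 mul1r.
  by rewrite {1}/position IH exprS rmorphM mulrA.
rewrite /poly_position fct_sumE horner_coef rmorph_sum mulr_suml.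
by apply: eq_bigr => i _; rewrite rmorphM/= -mulrA -itE.
Qed.

(** The factor [i] cancels the [1/i] of the momentum, so the operator is [u f' + i P f], split here
    into real and imaginary parts. *)
Lemma weyl_opE u P f x : 'i%C * weyl_op u P f x =
  (u * ((Re \o f)^`())%classic x - P.[x] * Im (f x)) +i*
  (u * ((Im \o f)^`())%classic x + P.[x] * Re (f x)).
Proof.
rewrite /weyl_op [X in 'i%C * X](_ : _ = u%:C * momentum f x + P.[x]%:C * f x); last first.
  by rewrite -poly_positionE.
rewrite /momentum mulrDr mulrCA mulVKf; last by rewrite eq_complex/= negb_and oner_eq0 orbT.
by case: (f x) => a b; apply/eqP; rewrite eq_complex/=; apply/andP; split; apply/eqP; ring.
Qed.

Definition idiff u P f : R -> R[i] := fun x => 'i%C * weyl_op u P f x.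

Lemma test_idiff u P f : test_function f -> test_function (idiff u P f).
Proof.
move=> /test_functionP[rf jf [M HM]].
have dz (h : R -> R) x : (forall x, M < `|x| -> h x = 0) -> M < `|x| -> (h^`())%classic x = 0.
  move=> hM Mx; rewrite -(@derive1_cst R _ (0 : R) x) !derive1E.
  apply: near_eq_derive.
  have cn : continuous (fun y : R => `|y|) by move=> y; exact: norm_continuous.
  near=> y; rewrite hM//; near: y.
  exact: (cvgr_gt _ (cn x) _ Mx).
apply/test_functionP; split.
- rewrite (_ : _ \o _ = (cst u \* ((Re \o f)^`())%classic) \+
    (cst (-1) \* (horner P \* (Im \o f)))).
    apply: smoothD; first exact: smoothM (smooth_cst u) (smooth_derive1 rf).
    exact: smoothM (smooth_cst (-1)) (smoothM (smooth_horner P) jf).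
  by apply/funext => x /=; rewrite /idiff weyl_opE /=; ring.
- rewrite (_ : _ \o _ = (cst u \* ((Im \o f)^`())%classic) \+ (horner P \* (Re \o f))).
    apply: smoothD; first exact: smoothM (smooth_cst u) (smooth_derive1 jf).
    exact: smoothM (smooth_horner P) rf.
  by apply/funext => x /=; rewrite /idiff weyl_opE.
- exists M => x Mx; rewrite /idiff weyl_opE (HM _ Mx)/= !dz//.
  + by rewrite !mulr0 subr0 addr0.
  + by move=> y /HM /= ->.
  + by move=> y /HM /= ->.
Unshelve. all: by end_near. Qed.

(** The phase contributes [i P(x + t u)] by [is_derive_theta] and the translation contributes
    [u f'(x + t u)]. The two components are kept apart because the mean value theorem is real. *)
Lemma is_derive_wt u P f x t : test_function f ->
  is_derive t (1 : R) (fun s => Re (wt (theta u P s) (s * u) f x))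
    (Re (wt (theta u P t) (t * u) (idiff u P f) x)) /\
  is_derive t (1 : R) (fun s => Im (wt (theta u P s) (s * u) f x))
    (Im (wt (theta u P t) (t * u) (idiff u P f) x)).
Proof.
move=> [rf jf _].
have dth := is_derive_theta u P x t.
have dcos := is_derive1_comp (is_derive_cos _) dth.
have dsin := is_derive1_comp (is_derive_sin _) dth.
have sh (h : R -> R) : smooth h -> is_derive t (1 : R) (fun s => h (x + s * u))
    (u * (h^`())%classic (x + t * u)).
  move=> sm; have := @is_derive_affine _ h u x t _ (smooth_is_derive _ sm).
  rewrite addrC [u * t]mulrC; congr (is_derive _ _ _ _).
  by apply/funext => s; rewrite addrC mulrC.
have dr := sh _ rf; have dj := sh _ jf; split.
  have := is_deriveB (is_deriveM dcos dr) (is_deriveM dsin dj).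
  congr (is_derive _ _ _ _).
    by apply/funext => s; rewrite /wt /phase /= !fctE /=; case: (f _).
  by rewrite /wt /idiff weyl_opE /phase /= /GRing.scale/=; ring.
have := is_deriveD (is_deriveM dcos dj) (is_deriveM dsin dr).
congr (is_derive _ _ _ _).
  by apply/funext => s; rewrite /wt /phase /= !fctE /=; case: (f _).
by rewrite /wt /idiff weyl_opE /phase /= /GRing.scale/=; ring.
Qed.

(** The mean value theorem for [h s - l s]; [l = 0] serves for Lipschitz bounds, [l = dh 0] for
    second order ones. *)
Lemma mean_value_real h (dh : R -> R) (l c t : R) :
  (forall s, is_derive s (1 : R) h (dh s)) ->
  (forall s, `|s| <= `|t| -> `|dh s - l| <= c) ->
  `|h t - h 0 - t * l| <= c * `|t|.
Proof.
move=> dhE small; pose k s := h s - l * s.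
have dk s : is_derive s (1 : R) k (dh s - l).
  have := is_deriveB (dhE s) (is_deriveZ l (is_derive_id s (1 : R))).
  by rewrite /GRing.scale/= mulr1.
have ck : continuous k.
  by move=> s; apply/differentiable_continuous/derivable1_diffP.
have -> : h t - h 0 - t * l = k t - k 0 by rewrite /k; ring.
have [t0|t0] := leP 0 t.
  have [s] := MVT_segment t0 (fun s _ => dk s) (continuous_subspaceT ck).
  rewrite in_itv/= subr0 => /andP[s0 st] ->; rewrite normrM ler_wpM2r// small//.
  by rewrite !ger0_norm.
have [s] := MVT_segment (ltW t0) (fun s _ => dk s) (continuous_subspaceT ck).
rewrite in_itv/= sub0r distrC => /andP[ts s0] ->; rewrite normrM normrN ler_wpM2r//.
by rewrite small// !ler0_norm ?lerN2// ltW.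
Qed.

(** The factor 2 appears because each component of a product with a phase is a sum of two terms. *)
Lemma wt_bounded p (a : R) f K : (forall x, `|Re (f x)| <= K /\ `|Im (f x)| <= K) ->
  forall x, `|Re (wt p a f x)| <= 2 * K /\ `|Im (wt p a f x)| <= 2 * K.
Proof.
move=> HK x; have [h1 h2] := HK (x + a).
have K0 : 0 <= K by rewrite (le_trans _ h1).
have hc (b : R) : `|b| <= K -> `|cos p.[x] * b| <= K.
  move=> bK; rewrite normrM (le_trans (ler_wpM2l _ bK))// ler_piMl//.
  by rewrite ler_norml cos_geN1 cos_le1.
have hs (b : R) : `|b| <= K -> `|sin p.[x] * b| <= K.
  move=> bK; rewrite normrM (le_trans (ler_wpM2l _ bK))// ler_piMl//.
  by rewrite ler_norml sin_geN1 sin_le1.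
rewrite /wt /phase mulr2n mulrDl mul1r; case: (f _) h1 h2 => b c /= h1 h2; split.
  by rewrite (le_trans (ler_normB _ _))// lerD ?hc ?hs.
by rewrite (le_trans (ler_normD _ _))// lerD ?hc ?hs.
Qed.

End TestFunctions.

(** * Density of the test functions *)

Section Density.
Context {R : realType}.
Local Notation mu := (@lebesgue_measure R).
Local Notation L2 := (L2 R).
Local Notation mfun h := (measurable_fun [set: R] h).
Implicit Types (h k g : R -> R) (a b c e : R).

(** Squared L2 norm of a real function, possibly infinite. Approximation is done for real functions;
    real and imaginary parts are recombined at the end. *)
Definition sqd h : \bar R := (\int[mu]_x ((h x) ^+ 2)%:E)%E.

Lemma measurable_sq h : mfun h -> mfun (fun x => ((h x) ^+ 2)%:E).
Proof. by move=> mh; apply/measurable_EFinP/measurable_funX. Qed.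

Lemma le_sqd h k : mfun h -> mfun k -> (forall x, `|h x| <= `|k x|) ->
  (sqd h <= sqd k)%E.
Proof.
move=> mh mk hk; apply: ge0_le_integral => //.
- by move=> x _; rewrite lee_fin sqr_ge0.
- exact: measurable_sq.
- exact: measurable_sq.
- move=> x _; rewrite lee_fin -(real_normK (num_real (h x))).
  by rewrite -(real_normK (num_real (k x))) lerXn2r ?nnegrE.
Qed.

Lemma sqdZ c h : mfun h -> sqd (fun x => c * h x) = ((c ^+ 2)%:E * sqd h)%E.
Proof.
move=> mh; rewrite /sqd -ge0_integralZl//.
- by apply: eq_integral => x _; rewrite -EFinM exprMn.
- exact: measurable_sq.
- by move=> x _; rewrite lee_fin sqr_ge0.
- by rewrite lee_fin sqr_ge0.
Qed.

Lemma sqdD h k : mfun h -> mfun k ->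
  (sqd (h \+ k)%R <= 2%:E * sqd h + 2%:E * sqd k)%E.
Proof.
move=> mh mk; have m2 (f : R -> R) : mfun f -> mfun (fun x => 2%:E * ((f x) ^+ 2)%:E)%E.
  by move=> mf; apply: measurable_funeM; exact: measurable_sq.
have g2 (f : R -> R) x : (0 <= 2%:E * ((f x) ^+ 2)%:E)%E.
  by rewrite -EFinM lee_fin mulr_ge0// sqr_ge0.
rewrite /sqd -!ge0_integralZl//; try (by exact: measurable_sq);
  try (by move=> x _; rewrite lee_fin sqr_ge0).
rewrite -ge0_integralD//; [|exact: m2..].
apply: ge0_le_integral => //.
- by move=> x _; rewrite lee_fin sqr_ge0.
- by apply: measurable_sq; exact: measurable_funD.
- by apply: emeasurable_funD; exact: m2.
- move=> x _; rewrite -!EFinM -EFinD lee_fin -subr_ge0.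
  by rewrite (_ : _ - _ = (h x - k x) ^+ 2) ?sqr_ge0//=; ring.
Qed.

Lemma le_half_half (x y : \bar R) e : (x <= (e / 4)%:E)%E -> (y <= (e / 4)%:E)%E ->
  (2%:E * x + 2%:E * y <= e%:E)%E.
Proof.
have -> : e%:E = (2%:E * (e / 4)%:E + 2%:E * (e / 4)%:E)%E.
  by rewrite -!EFinM -EFinD; congr EFin; lra.
by move=> xe ye; rewrite leeD// lee_wpmul2l.
Qed.

Definition approximable h := forall e, 0 < e -> exists g : R -> R,
  [/\ smooth g, exists M : R, forall x, M < `|x| -> g x = 0 &
      (sqd (h \- g)%R <= e%:E)%E].

Lemma measurable_smooth g : smooth g -> mfun g.
Proof. by move=> sg; apply: continuous_measurable_fun; exact: smooth_continuous. Qed.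

Lemma approximable_limit h : mfun h ->
    (forall e, 0 < e -> exists k, [/\ mfun k, approximable k & (sqd (h \- k)%R <= e%:E)%E]) ->
  approximable h.
Proof.
move=> mh H e e0; have e40 : 0 < e / 4 by rewrite divr_gt0.
have [k [mk ak hk]] := H _ e40; have [g [sg gM kg]] := ak _ e40.
exists g; split=> //.
have mg := measurable_smooth sg.
rewrite (_ : _ \- _ = (h \- k) \+ (k \- g)); last first.
  by apply/funext => x /=; ring.
apply: le_trans (sqdD (measurable_funB mh mk) (measurable_funB mk mg)) _.
exact: le_half_half.
Qed.

Lemma approximable_cst0 : approximable (cst 0).
Proof.
move=> e e0; exists (cst 0); split; [exact: smooth_cst|by exists 0|].
rewrite /sqd (eq_integral (cst 0%E)) ?integral0 ?lee_fin ?ltW// => x _.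
by rewrite /= subrr expr0n.
Qed.

Lemma approximable_lin c h k : mfun h -> mfun k -> approximable h -> approximable k ->
  approximable (fun x => c * h x + k x).
Proof.
move=> mh mk ah ak e e0.
have c0 : 0 < c ^+ 2 + 1 by rewrite ltr_wpDl// sqr_ge0.
(* The denominator absorbs the factor [c^2] produced by [sqdZ] and stays positive for [c = 0]. *)
have e1 : 0 < e / 4 / (c ^+ 2 + 1) by rewrite !divr_gt0.
have e2 : 0 < e / 4 by rewrite divr_gt0.
have [g [sg [M gM] hg]] := ah _ e1; have [f [sf [N fN] kf]] := ak _ e2.
have [mg mf] := (measurable_smooth sg, measurable_smooth sf).
exists ((cst c \* g) \+ f); split.
- exact: smoothD (smoothM (smooth_cst c) sg) sf.
- by exists (Num.max M N) => x; rewrite gt_max => /andP[/gM /= -> /fN ->]; rewrite mulr0 addr0.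
- rewrite (_ : _ \- _ = (fun x => c * (h \- g) x) \+ (k \- f)); last first.
    by apply/funext => x /=; ring.
  have mhg : mfun (h \- g) by exact: measurable_funB.
  apply: le_trans (sqdD _ (measurable_funB mk mf)) _; first exact: measurable_funM.
  apply: le_half_half => //; rewrite sqdZ//.
  apply: le_trans (lee_wpmul2l _ hg) _; first by rewrite lee_fin sqr_ge0.
  rewrite -EFinM lee_fin mulrA ler_pdivrMr// mulrC ler_wpM2l ?(ltW e2)//.
  by rewrite lerDl.
Qed.

(** Dominated convergence for [(h - h_ n)^2], which tends to 0 and is dominated by [4 G^2]. *)
Lemma approximable_dct (G h : R -> R) (h_ : nat -> R -> R) :
    mfun G -> (sqd G < +oo)%E -> mfun h -> (forall n, mfun (h_ n)) ->
    (forall n, approximable (h_ n)) ->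
    (forall x, h_ n x @[n --> \oo] --> h x) ->
    (forall n x, `|h_ n x| <= G x) ->
  approximable h.
Proof.
move=> mG G2 mh mh_ ah_ h_h hG; apply: approximable_limit => // e e0.
have hG' x : `|h x| <= G x.
  apply: (cvgr_to_le (cvg_norm (h_h x))); near=> n; exact: hG.
have mF n : mfun (fun x => ((h x - h_ n x) ^+ 2)%:E).
  by apply: measurable_sq; exact: measurable_funB.
have G0 x : (0 <= 4%:E * ((G x) ^+ 2)%:E)%E by rewrite -EFinM lee_fin mulr_ge0// sqr_ge0.
have iG : mu.-integrable setT (fun x => (4%:E * ((G x) ^+ 2)%:E)%E).
  apply/integrableP; split; first by apply: measurable_funeM; exact: measurable_sq.
  have -> : (\int[mu]_x `|4%:E * ((G x) ^+ 2)%:E| = \int[mu]_x (4%:E * ((G x) ^+ 2)%:E))%E.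
    by apply: eq_integral => x _; rewrite gee0_abs.
  rewrite ge0_integralZl//; last 2 first.
    exact: measurable_sq.
    by move=> x _; rewrite lee_fin sqr_ge0.
  by rewrite lte_mul_pinfty.
have cF x : ((h x - h_ n x) ^+ 2)%:E @[n --> \oo] --> 0%E.
  apply: cvg_EFin; first exact: nearW.
  have hh : h x - h_ n x @[n --> \oo] --> 0.
    by rewrite -(subrr (h x)); apply: cvgB => //; exact: cvg_cst.
  rewrite -(mulr0 0); apply: cvg_trans (cvgM hh hh).
  by apply: near_eq_cvg; apply: nearW => n; rewrite /= expr2.
have FG n x : (`| ((h x - h_ n x) ^+ 2)%:E | <= 4%:E * ((G x) ^+ 2)%:E)%E.
  rewrite -EFinM /= lee_fin ger0_norm ?sqr_ge0//.
  rewrite (_ : 4 * G x ^+ 2 = (G x + G x) ^+ 2); last by ring.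
  rewrite -(real_normK (num_real (h x - _))) lerXn2r ?nnegrE//.
    by rewrite addr_ge0// (le_trans _ (hG' x)).
  by rewrite (le_trans (ler_normB _ _))// lerD.
have aeF : {ae mu, forall x, setT x -> ((h x - h_ n x) ^+ 2)%:E @[n --> \oo] --> cst 0%E x}.
  by apply: aeW => x _; exact: cF.
have aeG : {ae mu, forall x n, setT x ->
    (`| ((h x - h_ n x) ^+ 2)%:E | <= 4%:E * ((G x) ^+ 2)%:E)%E}.
  by apply: aeW => x n _; exact: FG.
have [_ _] := @dominated_convergence _ _ _ mu setT measurableT
  (fun n x => ((h x - h_ n x) ^+ 2)%:E) (cst 0%E) _ mF (@measurable_cst _ _ _ _ setT 0%E)
  aeF iG aeG.
rewrite integral0 => cv0.
have [N _ HN] := cv0 _ (@open_ereal_lt' _ 0%E e%:E e0).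
exists (h_ N); split=> //.
exact: ltW (HN N (leqnn N)).
Unshelve. all: by end_near. Qed.

Local Notation J N := (`](- N%:R), N%:R[%classic : set R).

Lemma sqd_indic (A : set R) : measurable A -> sqd \1_A = mu A.
Proof.
move=> mA; transitivity (mu (A `&` setT)); last by rewrite setIT.
rewrite /sqd -integral_indic//; apply: eq_integral => x _.
by rewrite indicE; case: (x \in A); rewrite ?expr1n ?expr0n.
Qed.

Lemma sqd_indicJ a b : (sqd \1_(`]a, b[%classic) < +oo)%E.
Proof.
rewrite sqd_indic// lebesgue_measure_itv/=; case: ifPn => // _.
by rewrite -EFinB ltry.
Qed.

Lemma approximable_itv a b : approximable \1_(`]a, b[%classic).
Proof.
apply: (@approximable_dct \1_(`]a, b[%classic) _ (bump a b)).
- exact: measurable_indic.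
- exact: sqd_indicJ.
- exact: measurable_indic.
- by move=> n; apply: measurable_smooth; exact: smooth_bump.
- move=> n e e0; exists (bump a b n); split; first exact: smooth_bump.
    exists (Num.max `|a| `|b|) => x; rewrite gt_max => /andP[ax bx].
    apply: bump_out; apply/negP => /andP[xa xb].
    have [x0|x0] := leP 0 x.
      by move: bx; rewrite (ger0_norm x0) ltNge ltW// (lt_le_trans xb)// ler_norm.
    move: ax; rewrite (ltr0_norm x0) ltNge ltW// (lt_le_trans (_ : _ < - a)) ?ltrN2//.
    by rewrite -normrN ler_norm.
  rewrite /sqd (eq_integral (cst 0%E)) ?integral0 ?lee_fin ?ltW// => x _.
  by rewrite /= subrr expr0n.
- by move=> x; exact: bump_cvg.
- move=> n x; rewrite ger0_norm ?bump_ge0// indicE.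
  have [_|xab] := boolP (x \in _); first exact: bump_le1.
  by rewrite bump_out//; rewrite notin_setE/= in_itv/= in xab; apply/negP.
Qed.

(** Dynkin induction from the open rays, which generate the measurable sets and are stable under
    intersection. Cutting with the bounded interval [J N] keeps all the sets, complements included,
    of finite measure. *)
Lemma approximable_indic N (A : set R) : measurable A ->
  approximable (\1_(A `&` J N)).
Proof.
have mE : (@measurable _ R : set (set R)) = <<s @RGenOInfty.G R >>.
  exact: RGenOInfty.measurableE.
move=> mA; rewrite mE in mA; move: A mA.
apply: (@dynkin_induction _ R (@RGenOInfty.G R)
  (fun A => approximable (\1_(A `&` J N)))) => //.
- move=> _ _ [x ->] [y ->]; exists (Num.max x y); apply/seteqP; split=> z /=.
    by rewrite !in_itv/= !andbT gt_max => -[-> ->].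
  by rewrite !in_itv/= !andbT gt_max => /andP[].
- by rewrite setTI; exact: approximable_itv.
- move=> _ [x ->].
  rewrite (_ : _ `&` _ = `]Num.max x (- N%:R), N%:R[%classic); last first.
    apply/seteqP; split=> z /=; rewrite !in_itv/= !andbT gt_max.
      by case=> -> /andP[-> ->].
    by case/andP=> /andP[-> ->] ->.
  exact: approximable_itv.
- move=> A mA aA.
  rewrite (_ : \1_ _ = fun x => -1 * \1_(A `&` J N) x + \1_(J N) x).
    apply: approximable_lin => //; last exact: approximable_itv.
    by apply: measurable_indic; exact: measurableI.
  apply/funext => x; rewrite !indicE !in_setI in_setC.
  by case: (x \in A); case: (x \in J N) => /=; rewrite ?mulr0 ?mulr1 ?addNr ?add0r.
(* A disjoint union is the pointwise limit of its finite subunions, all dominated by the indicator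
   of [J N]. *)
- move=> F mF tF aF.
  pose S n := \big[setU/set0]_(i < n) F i.
  have mS n : measurable (S n) by exact: bigsetU_measurable.
  apply: (@approximable_dct \1_(J N) _ (fun n => \1_(S n `&` J N))).
  + exact: measurable_indic.
  + exact: sqd_indicJ.
  + by apply: measurable_indic; apply: measurableI => //; exact: bigcup_measurable.
  + by move=> n; apply: measurable_indic; exact: measurableI.
  + elim=> [|n IH]; first by rewrite /S big_ord0 set0I indic0; exact: approximable_cst0.
    rewrite (_ : \1_ _ = fun x => 1 * \1_(F n `&` J N) x + \1_(S n `&` J N) x).
      by apply: approximable_lin => //; apply: measurable_indic; exact: measurableI.
    apply/funext => x; rewrite !indicE /S big_ord_recr/= !in_setI in_setU mul1r.
    have [xF|xF] := boolP (x \in F n); last by rewrite orbF add0r.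
    rewrite (_ : x \in _ = false) /= ?addr0//; apply/negP; rewrite inE -bigcup_mkord.
    move=> [i /= ni Fix]; move: tF => /trivIsetP/(_ i n I I); rewrite lt_eqF//.
    by move=> /(_ isT)/seteqP[/(_ x) + _]; apply; split=> //; rewrite inE in xF.
  + move=> x; have [[i _ Fix]|nF] := pselect ((\bigcup_k F k) x).
      apply: cvg_near_cst; exists i.+1 => // n /= ni.
      rewrite !indicE !in_setI; congr ((_ && _)%:R).
      transitivity true; first by apply/mem_set; rewrite /S -bigcup_mkord; exists i.
      by apply/esym/mem_set; exists i.
    apply: cvg_near_cst; apply: nearW => n; rewrite !indicE !in_setI; congr ((_ && _)%:R).
    transitivity false; last by apply/esym/memNset.
    by apply/memNset => Sx; apply: nF; move: Sx; rewrite /S -bigcup_mkord => -[i _ Fi]; exists i.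
  + move=> n x; rewrite !indicE in_setI; case: (_ \in J N); rewrite ?andbF ?andbT.
      by case: (_ \in _); rewrite ?normr1 ?normr0.
    by rewrite normr0.
Qed.

Import HBNNSimple.

Lemma approximable_nnsfun N (f : {nnsfun R >-> R}) :
  approximable (fun x => f x * \1_(J N) x).
Proof.
(* Listing the finite range of [f] reduces the claim to an induction over a list of weighted
   indicators. *)
pose s : seq R := finmap.enum_fset (fset_set (f @` setT)).
rewrite (_ : (fun _ => _) =
    fun x => \sum_(r <- s) (r * \1_(f @^-1` [set r] `&` J N) x)); last first.
  apply/funext => x; rewrite fimfunE fsbig_finite//= mulr_suml.
  by apply: eq_bigr => r _; rewrite -mulrA indicI.
have mA r : measurable (f @^-1` [set r]) by exact: measurable_sfunP.
elim: s => [|r s IH].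
  rewrite (_ : (fun _ => _) = cst 0); first exact: approximable_cst0.
  by apply/funext => x; rewrite big_nil.
rewrite (_ : (fun _ => _) = fun x => r * \1_(f @^-1` [set r] `&` J N) x +
    \sum_(t <- s) (t * \1_(f @^-1` [set t] `&` J N) x)); last first.
  by apply/funext => x; rewrite big_cons.
apply: approximable_lin => //.
- by apply: measurable_indic; exact: measurableI.
- apply: measurable_sum => t; apply: measurable_funM => //.
  by apply: measurable_indic; exact: measurableI.
- exact: approximable_indic.
Qed.

(** Simple functions increasing to [h], cut off to [J n], converge pointwise and are dominated by
    [h] itself. *)
Lemma approximable_ge0 h : mfun h -> (forall x, 0 <= h x) -> (sqd h < +oo)%E ->
  approximable h.
Proof.
move=> mh h0 h2; have mh' : mfun (EFin \o h) by exact/measurable_EFinP.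
have h0' x : setT x -> (0 <= (EFin \o h) x)%E by rewrite /= lee_fin.
pose f := nnsfun_approx measurableT mh'.
have fh n x : f n x <= h x.
  by rewrite -lee_fin nnsfun_approxE; exact: (le_approx _ h0').
have cf x : f n x @[n --> \oo] --> h x.
  have := cvg_nnsfun_approx measurableT mh' h0' (I : setT x).
  by move=> /fine_cvgP[_].
have mf n : mfun (f n) by exact: measurable_funP.
apply: (@approximable_dct h _ (fun n x => f n x * \1_(J n) x)) => //.
- move=> n; apply: measurable_funM => //; exact: measurable_indic.
- by move=> n; exact: approximable_nnsfun.
- move=> x; rewrite -[h x]mulr1; apply: cvgM => //.
  apply: cvg_near_cst; near=> n; rewrite indicE mem_set//= in_itv/= -ltr_norml.
  near: n; have /cvgryPgt := @cvgr_idn R; exact.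
- move=> n x; rewrite normrM ger0_norm// indicE.
  have [_|_] := boolP (x \in _); first by rewrite normr1 mulr1.
  by rewrite normr0 mulr0.
Unshelve. all: by end_near. Qed.

Lemma approximable_sqd h : mfun h -> (sqd h < +oo)%E -> approximable h.
Proof.
move=> mh h2.
have mp : mfun (fun x => Num.max (h x) 0) by exact: measurable_maxr.
have mn : mfun (fun x => Num.max (- h x) 0).
  by apply: measurable_maxr => //; exact: measurable_funN.
rewrite (_ : h = fun x => -1 * Num.max (- h x) 0 + Num.max (h x) 0); last first.
  apply/funext => x; rewrite mulN1r; have [x0|x0] := leP 0 (h x).
    by rewrite max_r ?oppr_le0// oppr0 add0r.
  by rewrite max_l ?oppr_ge0 ?ltW// opprK addr0.
apply: approximable_lin => //; apply: approximable_ge0 => //.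
- by move=> x; rewrite le_max lexx orbT.
- apply: le_lt_trans h2; apply: le_sqd => // x.
  by rewrite ger0_norm ?le_max ?lexx ?orbT// ge_max normr_ge0 andbT -normrN ler_norm.
- by move=> x; rewrite le_max lexx orbT.
- apply: le_lt_trans h2; apply: le_sqd => // x.
  by rewrite ger0_norm ?le_max ?lexx ?orbT// ge_max normr_ge0 andbT ler_norm.
Qed.

Lemma test_function_dense (phi : L2) e : 0 < e -> exists2 f : R -> R[i],
  test_function f & forall psi : L2, (\forall x \ae mu, psi x = f x) ->
    nrm (psi - phi) <= e.
Proof.
have F := ae_filter_ringOfSetsType mu.
move=> e0; have [mr mj] := cmeasurable_L2 phi.
have phi2 : (\int[mu]_x ((modulus (phi x)) ^+ 2)%:E < +oo)%E by rewrite -nrm_sqr ltry.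
have sub h : mfun h -> (forall x, (h x) ^+ 2 <= (modulus (phi x)) ^+ 2) -> approximable h.
  move=> mh hphi; apply: approximable_sqd => //; apply: le_lt_trans phi2.
  apply: ge0_le_integral => //.
  - by move=> x _; rewrite lee_fin sqr_ge0.
  - exact: measurable_sq.
  - exact: measurable_modulus_sqr (cmeasurable_L2 phi).
  - by move=> x _; rewrite lee_fin.
(* Half of the squared error is granted to each of the real and imaginary parts. *)
have e2 : 0 < e ^+ 2 / 2 by rewrite divr_gt0// exprn_gt0.
have [g [sg [M gM] gr]] : exists g : R -> R, [/\ smooth g,
    exists M : R, forall x, M < `|x| -> g x = 0 &
    (sqd (((@complex.Re R) \o phi) \- g)%R <= (e ^+ 2 / 2)%:E)%E].
  by apply: sub => // x; rewrite modulus_sqr lerDl sqr_ge0.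
have [h [sh [N hN] hj]] : exists g : R -> R, [/\ smooth g,
    exists M : R, forall x, M < `|x| -> g x = 0 &
    (sqd (((@complex.Im R) \o phi) \- g)%R <= (e ^+ 2 / 2)%:E)%E].
  by apply: sub => // x; rewrite modulus_sqr lerDr sqr_ge0.
exists (fun x => g x +i* h x).
  apply/test_functionP; split; [exact: sg|exact: sh|].
  by exists (Num.max M N) => x; rewrite gt_max => /andP[/gM -> /hN ->].
move=> psi psif.
rewrite -(@ler_pXn2r _ 2%N) ?nnegrE ?nrm_ge0 ?(ltW e0)// -lee_fin nrm_sqr.
have [mg mh] := (measurable_smooth sg, measurable_smooth sh).
have mrg := measurable_sq (measurable_funB mr mg).
have mjh := measurable_sq (measurable_funB mj mh).
have -> : (e ^+ 2)%:E = ((e ^+ 2 / 2)%:E + (e ^+ 2 / 2)%:E)%E.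
  by rewrite -EFinD -splitr.
apply: le_trans (leeD gr hj); rewrite /sqd -ge0_integralD//; last 2 first.
- by move=> x _; rewrite lee_fin sqr_ge0.
- by move=> x _; rewrite lee_fin sqr_ge0.
rewrite le_eqVlt; apply/orP; left; apply/eqP; apply: ge0_ae_eq_integral => //.
- exact: measurable_modulus_sqr (cmeasurable_L2 _).
- exact: emeasurable_funD.
- by move=> x _; rewrite lee_fin sqr_ge0.
- by move=> x _; rewrite -EFinD lee_fin addr_ge0// sqr_ge0.
apply: filter_app (L2funN phi); apply: filter_app (L2funD psi (- phi)).
apply: filterS psif => x fx Dx Nx _.
rewrite Dx Nx fx modulus_sqr -EFinD; congr EFin => /=.
by case: (L2fun phi x) => a b /=; ring.
Qed.

End Density.

(** * The Weyl operators *)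

Section WeylGroup.
Context {R : realType}.
Local Notation mu := (@lebesgue_measure R).
Local Notation L2 := (L2 R).
Local Open Scope quotient_scope.
Implicit Types (phi psi chi : L2) (u v s t : R) (P Q : {poly R}).

Definition weyl_group u P t : L2 -> L2 := wtL (theta u P t) (t * u).

Lemma weyl_groupD u P s t phi :
  weyl_group u P (s + t) phi = weyl_group u P s (weyl_group u P t phi).
Proof.
rewrite /weyl_group wtL_comp -mulrDl.
apply: (congr1 (fun V : L2 -> L2 => V phi)); apply: eq_wtL => x.
by rewrite !(hornerD, horner_comp, hornerX, hornerC) thetaD.
Qed.

Lemma weyl_group0 u P phi : weyl_group u P 0 phi = phi.
Proof. by rewrite /weyl_group theta0 mul0r wtL0. Qed.

Lemma wt00 (f : R -> R[i]) x : wt 0 0 f x = f x.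
Proof. by rewrite /wt horner0 phase0 mul1r addr0. Qed.

Let reB (z w : R[i]) : complex.Re (z - w) = complex.Re z - complex.Re w.
Proof. by case: z w => [? ?] []. Qed.

Let imB (z w : R[i]) : complex.Im (z - w) = complex.Im z - complex.Im w.
Proof. by case: z w => [? ?] []. Qed.

Let reZ (c : R) (z : R[i]) : complex.Re (c%:C * z) = c * complex.Re z.
Proof. by case: z => ? ? /=; rewrite mul0r subr0. Qed.

Let imZ (c : R) (z : R[i]) : complex.Im (c%:C * z) = c * complex.Im z.
Proof. by case: z => ? ? /=; rewrite mul0r addr0. Qed.

Lemma wt_lipschitz u P (f : R -> R[i]) : test_function f ->
  exists2 K : R, 0 <= K & forall t x,
    `|complex.Re (wt (theta u P t) (t * u) f x - f x)| <= K * `|t| /\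
    `|complex.Im (wt (theta u P t) (t * u) f x - f x)| <= K * `|t|.
Proof.
move=> tf; have [K K0 HK] := test_bounded (test_idiff u P tf).
exists (2 * K) => [|t x]; first by rewrite mulr_ge0.
have b s := wt_bounded (theta u P s) (s * u) HK x.
split.
  have := @mean_value_real _ _ _ 0 (2 * K) t (fun s => (is_derive_wt u P x s tf).1).
  rewrite mulr0 subr0 theta0 mul0r wt00 reB; apply => s _.
  by rewrite subr0; case: (b s).
have := @mean_value_real _ _ _ 0 (2 * K) t (fun s => (is_derive_wt u P x s tf).2).
rewrite mulr0 subr0 theta0 mul0r wt00 imB; apply => s _.
by rewrite subr0; case: (b s).
Qed.

(** The derivative at time [s] differs from its value at 0 by at most [K |s|]: this is
    [wt_lipschitz] for the test function [idiff u P f]. *)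
Lemma wt_derive_bound u P (f : R -> R[i]) : test_function f ->
  exists2 K : R, 0 <= K & forall t x,
    `|complex.Re (wt (theta u P t) (t * u) f x - f x - t%:C * idiff u P f x)|
       <= K * `|t| * `|t| /\
    `|complex.Im (wt (theta u P t) (t * u) f x - f x - t%:C * idiff u P f x)|
       <= K * `|t| * `|t|.
Proof.
move=> tf; have [K K0 HK] := wt_lipschitz u P (test_idiff u P tf).
exists K => // t x; split.
  have := @mean_value_real _ _ _ (complex.Re (idiff u P f x)) (K * `|t|) t
    (fun s => (is_derive_wt u P x s tf).1).
  rewrite theta0 mul0r wt00 !reB reZ; apply => s st.
  by rewrite -reB; case: (HK s x) => /le_trans + _; apply; rewrite ler_wpM2l.
have := @mean_value_real _ _ _ (complex.Im (idiff u P f x)) (K * `|t|) t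
  (fun s => (is_derive_wt u P x s tf).2).
rewrite theta0 mul0r wt00 !imB imZ; apply => s st.
by rewrite -imB; case: (HK s x) => _ /le_trans; apply; rewrite ler_wpM2l.
Qed.

Lemma weyl_group_test_cont u P (f : R -> R[i]) phi : test_function f ->
  (\forall x \ae mu, phi x = f x) ->
  exists2 C : R, 0 <= C & forall t, `|t| <= 1 -> nrm (weyl_group u P t phi - phi) <= C * `|t|.
Proof.
have F := ae_filter_ringOfSetsType mu.
move=> tf phif; have [K K0 HK] := wt_lipschitz u P tf.
have /test_functionP[_ _ [M fM]] := tf.
(* For [|t| <= 1] the support moves by at most [|u|], so one segment serves all these [t]. *)
pose N := Num.max M 0 + `|u|.
have N0 : 0 <= N by rewrite addr_ge0// le_max lexx orbT.
exists (Num.sqrt (4 * N) * K); first by rewrite mulr_ge0// sqrtr_ge0.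
move=> t t1; rewrite -mulrA.
pose g x := wt (theta u P t) (t * u) f x - f x.
apply: (@nrm_le_supp _ _ g) => //.
- have := cmeasurableD (cmeasurable_wt (theta u P t) (t * u) (cmeasurable_test tf))
    (cmeasurableM (cmeasurable_cst (-1)) (cmeasurable_test tf)).
  by congr cmeasurable; apply/funext => x; rewrite /g fctE/= mulN1r.
- by rewrite mulr_ge0.
- apply: filter_app (L2funN phi); apply: filter_app (L2funD (weyl_group u P t phi) (- phi)).
  apply: filterS2 phif (wtL_pi (theta u P t) (t * u) phif) => x h1 h2 h3 h4.
  by rewrite h3 h4 h2 h1.
- move=> x Nx; rewrite /g (wt_supp _ fM)//.
    rewrite fM ?subrr//; apply: le_lt_trans Nx.
    by rewrite /N (le_trans (_ : _ <= Num.max M 0)) ?lerDl// le_max lexx.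
  apply: le_lt_trans Nx; rewrite lerD// ?le_max ?lexx//.
  by rewrite normrM ler_piMl.
- exact: HK t.
Qed.

Lemma weyl_group_test_gen u P (f : R -> R[i]) phi chi : test_function f ->
  (\forall x \ae mu, phi x = f x) -> (\forall x \ae mu, chi x = idiff u P f x) ->
  gen (weyl_group u P) phi chi.
Proof.
have F := ae_filter_ringOfSetsType mu.
move=> tf phif chif; have [K K0 HK] := wt_derive_bound u P tf.
have tg := test_idiff u P tf.
have /test_functionP[_ _ [M fM]] := tf.
have /test_functionP[_ _ [M' gM]] := tg.
pose N := Num.max (Num.max M M') 0 + `|u|.
have N0 : 0 <= N by rewrite addr_ge0// le_max lexx orbT.
pose C := Num.sqrt (4 * N) * K; have C0 : 0 <= C by rewrite mulr_ge0// sqrtr_ge0.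
move=> e e0; have C1 : 0 < C + 1 by rewrite ltr_wpDl.
(* The bound 1 confines the supports to one segment; the other makes [C |t|^2] at most [e |t|]. *)
exists (Num.min 1 (e / (C + 1))); first by rewrite lt_min ltr01 divr_gt0.
move=> t; rewrite le_min => /andP[t1 te].
apply: (@le_trans _ _ (C * `|t| * `|t|)); last first.
  rewrite ler_wpM2r// (le_trans (ler_wpM2l C0 te))// mulrCA ger_pMr//.
  by rewrite ler_pdivrMr// mul1r lerDl.
rewrite /C -!mulrA [K * _]mulrA.
pose g x := wt (theta u P t) (t * u) f x - f x - t%:C * idiff u P f x.
have MN : M <= Num.max (Num.max M M') 0 by rewrite !le_max lexx.
have MN' : M' <= Num.max (Num.max M M') 0 by rewrite !le_max lexx orbT.
apply: (@nrm_le_supp _ _ g) => //.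
- have := cmeasurableD (cmeasurableD (cmeasurable_wt (theta u P t) (t * u) (cmeasurable_test tf))
    (cmeasurableM (cmeasurable_cst (-1)) (cmeasurable_test tf)))
    (cmeasurableM (cmeasurable_cst (- t%:C)) (cmeasurable_test tg)).
  by congr cmeasurable; apply/funext => x; rewrite /g !fctE/= mulN1r mulNr.
- by rewrite !mulr_ge0.
- apply: filter_app (L2funN phi); apply: filter_app (L2funD (weyl_group u P t phi) (- phi)).
  apply: filter_app (L2funN (t%:C *: chi)); apply: filter_app (L2funZ t%:C chi).
  apply: filter_app (L2funD (weyl_group u P t phi - phi) (- (t%:C *: chi))).
  apply: filterS3 phif chif (wtL_pi (theta u P t) (t * u) phif) => x h1 h1' h2 h3 h4 h5 h6 h7.
  by rewrite h3 h5 h4 h6 h7 h2 h1 h1'.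
- move=> x Nx; rewrite /g (wt_supp _ fM)//.
    have hx (m : R) : m <= Num.max (Num.max M M') 0 -> m < `|x|.
      by move=> mm; apply: le_lt_trans Nx; rewrite /N (le_trans mm)// lerDl.
    by rewrite fM ?hx// gM ?hx// mulr0 !subr0.
  apply: le_lt_trans Nx; rewrite lerD//.
  by rewrite normrM ler_piMl.
- exact: HK t.
Qed.

Lemma weyl_group_isometry u P : isometry_group (weyl_group u P).
Proof.
split.
- by move=> t; exact: wtL_linear.
- by move=> t phi; exact: wtL_nrm.
- exact: weyl_group0.
- exact: weyl_groupD.
- move=> phi e e0; have e40 : 0 < e / 4 by rewrite divr_gt0.
  have [f tf fphi] := test_function_dense phi e40.
  pose psi : L2 := \pi_L2 (SqFun (sqint_test tf)).
  have psif : \forall x \ae mu, psi x = f x by exact: L2fun_pi.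
  have {}fphi := fphi _ psif.
  have [C C0 HC] := weyl_group_test_cont u P tf psif.
  have C1 : 0 < C + 1 by rewrite ltr_wpDl.
  exists (Num.min 1 (e / 4 / (C + 1))); first by rewrite lt_min ltr01 divr_gt0.
  move=> t; rewrite le_min => /andP[t1 te].
  (* The first two terms are at most [e / 4] since [psi] is close to [phi]; the last obeys the
     Lipschitz bound for test functions. *)
  have -> : weyl_group u P t phi - phi =
      (psi - phi) - weyl_group u P t (psi - phi) + (weyl_group u P t psi - psi).
    have := @wtL_linear _ (theta u P t) (t * u) (-1) phi psi.
    rewrite /= !scaleN1r [- phi + psi]addrC -!/(weyl_group u P t _) => ->.
    by zmod.
  apply: le_trans (nrmD _ _) _; apply: le_trans (lerD (nrmD _ _) (HC t t1)) _.
  rewrite nrmN wtL_nrm.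
  have : C * `|t| <= e / 4.
    rewrite (le_trans (ler_wpM2l C0 te))// mulrCA ger_pMr//.
    by rewrite ler_pdivrMr// mul1r lerDl.
  lra.
Qed.

Lemma L2_test (f : R -> R[i]) : test_function f ->
  exists phi : L2, \forall x \ae mu, phi x = f x.
Proof. by move=> tf; exists (\pi_L2 (SqFun (sqint_test tf))); exact: L2fun_pi. Qed.

(** The factor [i] is built into the second component, so that the graph compares directly with
    [gen]. *)
Definition test_graph u P : set (L2 * L2) := [set w | exists f, [/\ test_function f,
  \forall x \ae mu, L2fun w.1 x = f x & \forall x \ae mu, L2fun w.2 x = idiff u P f x]].

Lemma test_graph_generator u P w : weyl_generator u P w <-> test_graph u P (w.1, 'i%C *: w.2).
Proof.
have F := ae_filter_ringOfSetsType mu.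
split=> -[f [tf w1 w2]]; exists f; split=> //=.
  by apply: filterS2 (L2funZ 'i%C w.2) w2 => x -> ->.
apply: filterS2 (L2funZ 'i%C w.2) w2 => x -> /=.
rewrite /idiff => /mulfI; apply.
by rewrite eq_complex/= negb_and oner_eq0 orbT.
Qed.

Lemma idiff_linear u P (c : R) (f g : R -> R[i]) : test_function f -> test_function g ->
  idiff u P (fun x => c%:C * f x + g x) = (fun x => c%:C * idiff u P f x + idiff u P g x).
Proof.
move=> [rf jf _] [rg jg _]; apply/funext => x; rewrite /idiff !weyl_opE.
have d (h k : R -> R) : smooth h -> smooth k ->
    ((fun y => c * h y + k y)^`())%classic x = c * (h^`())%classic x + (k^`())%classic x.
  move=> sh sk; apply: is_derive_derive1.
  exact: (is_deriveD (is_deriveZ c (smooth_is_derive x sh)) (smooth_is_derive x sk)).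
rewrite (_ : _ \o (fun x => _) =
    fun y => c * (complex.Re (f y)) + complex.Re (g y)); last first.
  by apply/funext => y /=; case: (f y) (g y) => [? ?] [? ?] /=; ring.
rewrite (_ : (@complex.Im R) \o (fun x => _) =
    fun y => c * (complex.Im (f y)) + complex.Im (g y)); last first.
  by apply/funext => y /=; case: (f y) (g y) => [? ?] [? ?] /=; ring.
rewrite (d _ _ rf rg) (d _ _ jf jg); case: (f x) (g x) => [? ?] [? ?] /=.
by apply/eqP; rewrite eq_complex/=; apply/andP; split; apply/eqP; ring.
Qed.

Lemma weyl_is_expi u P : is_expi (closure (weyl_generator u P)) (weyl_group u P 1).
Proof.
have F := ae_filter_ringOfSetsType mu.
have UG := weyl_group_isometry u P.
exists (weyl_group u P); split=> //.
  by apply: isometry_group_unitary => // t phi psi; exact: wtL_dot.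
have gA w : test_graph u P w -> gen (weyl_group u P) w.1 w.2.
  by move=> [f [tf w1 w2]]; exact: weyl_group_test_gen tf w1 w2.
(* Closedness of the generator puts [i] times the closure inside it; [gen_core] gives the other
   inclusion. *)
apply/seteqP; split=> [[phi chi] /(generatorP _ _ UG) H|_ [z cz <-]]; last first.
  apply/(generatorP _ _ UG); apply: gen_closed => // e e0.
  have [w [Aw w1 w2]] := (L2_closureP _ _).1 cz e e0.
  exists (w.1, 'i%C *: w.2); split=> //=.
    by have := gA _ ((test_graph_generator u P w).1 Aw).
  by rewrite -scalerBr nrmZi.
(* The operator is [- i] times the generator. *)
exists (phi, - 'i%C *: chi); last first.
  congr pair => /=; rewrite scalerA (_ : _ * _ = 1) ?scale1r//.
  by apply/eqP; rewrite eq_complex/=; apply/andP; split; apply/eqP; ring.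
apply/L2_closureP => e e0.
have [|||w [Aw w1 w2]] := @gen_core _ _ UG (test_graph u P) gA _ _ _ phi chi H e e0.
- move=> a w w' [f [tf f1 f2]] [g [tg g1 g2]]; exists (fun x => a%:C * f x + g x); split => /=.
  + exact: test_lin.
  + apply: filter_app (L2funD (a%:C *: w.1) w'.1).
    by apply: filterS3 (L2funZ a%:C w.1) f1 g1 => x h1 h2 h3 ->; rewrite h1 h2 h3.
  + rewrite idiff_linear//; apply: filter_app (L2funD (a%:C *: w.2) w'.2).
    by apply: filterS3 (L2funZ a%:C w.2) f2 g2 => x h1 h2 h3 ->; rewrite h1 h2 h3.
- move=> t w [f [tf w1 w2]].
  have tUf := test_wt (theta u P t) (t * u) tf.
  have [psi psif] := L2_test (test_idiff u P tUf).
  by exists psi, (wt (theta u P t) (t * u) f); split=> //=; exact: wtL_pi.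
- move=> psi r r0; have [f tf fpsi] := test_function_dense psi r0.
  have [k kf] := L2_test tf; have [k' kf'] := L2_test (test_idiff u P tf).
  by exists (k, k'); [exists f|exact: fpsi].
exists (w.1, - 'i%C *: w.2); split=> //=.
  apply/test_graph_generator => /=; rewrite scalerA (_ : _ * _ = 1) ?scale1r//.
  by apply/eqP; rewrite eq_complex/=; apply/andP; split; apply/eqP; ring.
by rewrite -scalerBr scaleNr nrmN nrmZi.
Qed.

(** Both groups have the same generator, whose domain is dense because it contains the test
    functions. *)
Lemma is_expi_unique u P (V V' : L2 -> L2) :
  is_expi (closure (weyl_generator u P)) V ->
  is_expi (closure (weyl_generator u P)) V' -> V = V'.
Proof.
move=> [U [/unitary_group_isometry UG gU ->]] [U' [/unitary_group_isometry UG' gU' ->]].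
congr (_ 1); apply: isometry_group_unique => //.
  by move=> phi chi; rewrite -(generatorP phi chi UG) -(generatorP phi chi UG') gU gU'.
move=> phi e e0; have [f tf fphi] := test_function_dense phi e0.
have [k kf] := L2_test tf; have [k' kf'] := L2_test (test_idiff u P tf).
exists k, k'; split; last exact: fphi.
apply/generatorP => //; rewrite gU; exists (k, - 'i%C *: k'); last first.
  congr pair => /=; rewrite scalerA (_ : _ * _ = 1) ?scale1r//.
  by apply/eqP; rewrite eq_complex/=; apply/andP; split; apply/eqP; ring.
apply: subset_closure; apply/test_graph_generator => /=; exists f; split=> //=.
rewrite scalerA (_ : _ * _ = 1) ?scale1r//.
by apply/eqP; rewrite eq_complex/=; apply/andP; split; apply/eqP; ring.
Qed.

Lemma weylE n u (P : {poly_n.+1 R}) : weyl (u, P) = wtL (avg u P) u.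
Proof.
have W := weyl_is_expi u (P : {poly R}).
rewrite -theta1 -[X in wtL _ X](mul1r u) -/(weyl_group u P 1).
apply: (is_expi_unique _ W).
(* Existence ensures that [xget] returns a genuine exponential and not its default value. *)
have ex : exists V : L2 -> L2, [set V | is_expi (closure (weyl_generator u P)) V] V.
  by exists (weyl_group u P 1).
by have := xgetPex (idfun : L2 -> L2) ex.
Qed.

End WeylGroup.

(** * The composition law *)

Theorem theorem1 (R : realType) (n : nat) (hn : (1 <= n)%N)
    (u v : R) (P Q : {poly_n.+1 R}) :
  weyl (u, P) \o weyl (v, Q) = weyl (weyl_mul (u, P) (v, Q)).
Proof.
(* On the right the average over [u + v] cancels its inverse; on the left composition shifts the
   phase of the second factor by [u], and [avg_shift] moves the shift inside the average. *)
rewrite /weyl_mul /= !weylE -[in RHS]average_coef average_invK; apply/funext => phi /=.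
rewrite wtL_comp; apply: (congr1 (fun V : L2 R -> L2 R => V phi)).
apply: eq_wtL => x; rewrite /= !average_coef !hornerD avg_shift.
by rewrite !(hornerD, horner_comp, hornerX, hornerC).
Qed.
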